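(* Let $\mu$ be a compactly-supported signed measure on $\Omega$, let $\mathfrak{a}:=\mathrm{I}(\operatorname{supp}\mu)\subseteq L$ be the vanishing ideal of its support, and let $\sigma\colon L\to\mathbb{K}$ be its moment functional. Let $d\in\mathbb{N}$. Then $$\mathfrak{a}\cap R_{\le d}=\ker H_{d',d}$$ holds for all sufficiently large $d'\in\mathbb{N}$, where $H_{d',d}:=\bigl(\langle w,v\rangle_\sigma\bigr)_{w\in B^L_{d'},\,v\in B^R_d}$.
   Context: The statement concerns each of the following two settings ($n\in\mathbb{N}$). Affine case: $\Omega=\mathbb{R}^n$, $\mathbb{K}=\mathbb{R}$, $L=R=\mathbb{R}[x_1,\dots,x_n]$, and the involution $\circ$ on $\mathbb{K}$ and $L$ is the identity. Trigonometric case: $\Omega=\mathbb{T}^n=\{z\in\mathbb{C}^n:|z_1|=\dots=|z_n|=1\}$, $\mathbb{K}=\mathbb{C}$, $R=\mathbb{C}[x_1,\dots,x_n]$, $L=\mathbb{C}[x_1^{\pm1},\dots,x_n^{\pm1}]$, and the involution on $L$ is $\bigl(\sum_\alpha p_\alpha x^\alpha\bigr)^{\circ}=\sum_\alpha\overline{p_\alpha}\,x^{-\alpha}$. A signed measure on $\Omega$ is a $\mathbb{K}$-valued measure (real signed in the affine case, complex in the trigonometric case), viewed via the Riesz representation theorem as an element of the continuous dual of the space $C^0_c(\Omega)$ of compactly-supported continuous functions $\Omega\to\mathbb{K}$. Its support $\operatorname{supp}\mu$ is the set of $\xi\in\Omega$ such that $\mu|_U\ne0$ for every open neighborhood $U\subseteq\Omega$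 of $\xi$. For $X\subseteq\Omega$, $\mathrm{I}(X)=\{p\in L: p(\xi)=0\ \forall \xi\in X\}$. The moment functional is $\sigma(p)=\int_\Omega p\,\mathrm{d}\mu$, and $\langle q,p\rangle_\sigma:=\sigma(q^{\circ}p)$ for $q,p\in L$. A filtration of a $\mathbb{K}$-algebra $A$ is a family of $\mathbb{K}$-subspaces $\{F_d\}_{d\in\mathbb{N}}$ with $F_d\subseteq F_e$ for $d\le e$, $A=\bigcup_dF_d$, $1\in F_0$, $F_dF_e\subseteq F_{d+e}$. Fix filtrations $\{R_{\le d}\}_{d\in\mathbb{N}}$ of $R$ and $\{L_{\le d}\}_{d\in\mathbb{N}}$ of $L$, all of whose components are finite-dimensional. $B^R_d$ and $B^L_d$ denote arbitrary bases of $R_{\le d}$ and $L_{\le d}$. The kernel of $H_{d',d}$ is regarded as a subspace of $R_{\le d}$ via the basis $B^R_d$, i.e. $\ker H_{d',d}=\{p\in R_{\le d}:\langle q,p\rangle_\sigma=0\ \forall q\in L_{\le d'}\}$. *)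

(* Defs.v *)
From HB Require Import structures.
From mathcomp Require Import all_boot all_order all_algebra finmap.
From mathcomp Require Import all_classical all_reals all_analysis.
From mathcomp Require Import complex.
(* The notations of mpoly and monalg clash with those of mathcomp-analysis;
   both files define msupp and mcoeff, which are therefore qualified below. *)
From mathcomp Require Import -(notations) mpoly.
From mathcomp Require Import -(notations) monalg.

Set Implicit Arguments.
Unset Strict Implicit.
Unset Printing Implicit Defensive.

Import Order.TTheory GRing.Theory Num.Theory numFieldNormedType.Exports.

Local Open Scope ring_scope.

(* K[x_1^{+-1}, ..., x_n^{+-1}] as the finitely supported functions Z^n -> K
   with convolution.  monalg only multiplies when the exponents form a monoid
   without nontrivial units, so the ring structure is built here. *)
Definition laurent (n : nat) (K : fieldType) := malg 'rV[int]_n K.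

Section LaurentRing.
Context (n : nat) (K : fieldType).
Local Notation L := (laurent n K).
Implicit Types (p q : L) (a b : 'rV[int]_n) (c : K).

HB.instance Definition _ := GRing.Lmodule.on L.

Definition laurent_coef p a : K := monalg.mcoeff a p.

(* The term c x^a. *)
Definition laurent_term c a : L := mkmalgU a c.

Definition laurent_mul p q : L :=
  \sum_(a <- monalg.msupp p) \sum_(b <- monalg.msupp q)
    laurent_term (laurent_coef p a * laurent_coef q b) (a + b).

Local Open Scope fset_scope.

Let scaleT c c' a :
  c *: (mkmalgU a c' : malg 'rV[int]_n K) = mkmalgU a (c * c').
Proof. by apply/malgP => k; rewrite monalg.mcoeffZ [RHS]mcoeffU mcoeffU mulrnAr. Qed.

Let mulw (d1 d2 : {fset 'rV[int]_n}) p q :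
  monalg.msupp p `<=` d1 -> monalg.msupp q `<=` d2 ->
  laurent_mul p q = \sum_(a <- d1) \sum_(b <- d2)
    laurent_term (laurent_coef p a * laurent_coef q b) (a + b).
Proof.
move=> le1 le2; rewrite /laurent_mul (big_fset_incl _ le1) /=.
  apply/eq_bigr => a _; apply/big_fset_incl => // b _ /mcoeff_outdom qb.
  by rewrite /laurent_term /laurent_coef qb mulr0 monalgU0.
move=> a _ /mcoeff_outdom pa; rewrite big1 // => b _.
by rewrite /laurent_term /laurent_coef pa mul0r monalgU0.
Qed.

Let mulC : commutative laurent_mul.
Proof.
move=> p q; rewrite /laurent_mul exchange_big /=.
by do 2![apply/eq_bigr => ? _]; rewrite mulrC addrC.
Qed.

Let mulDl : left_distributive laurent_mul +%R.
Proof.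
move=> p q r.
rewrite (mulw (msuppD_le p q) (fsubset_refl _)).
rewrite (mulw (fsubsetUl (monalg.msupp p) (monalg.msupp q)) (fsubset_refl _)).
rewrite (mulw (fsubsetUr (monalg.msupp p) (monalg.msupp q)) (fsubset_refl _)).
rewrite -big_split /=; apply/eq_bigr => a _.
rewrite -big_split /=; apply/eq_bigr => b _.
by rewrite /laurent_term /laurent_coef monalg.mcoeffD mulrDl monalgUD.
Qed.

Let mulDr : right_distributive laurent_mul +%R.
Proof. by move=> p q r; rewrite !(mulC p) mulDl. Qed.

Let mul0 : left_zero 0 laurent_mul.
Proof. by move=> p; rewrite /laurent_mul monalg.msupp0 big_seq_fset0. Qed.

Let mulTT c1 c2 a b : laurent_mul (laurent_term c1 a) (laurent_term c2 b) =
  laurent_term (c1 * c2) (a + b).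
Proof.
rewrite (mulw msuppU_le msuppU_le) !big_seq_fset1.
by rewrite /laurent_coef !mcoeffUU.
Qed.

Let termE p : p = \sum_(a <- monalg.msupp p) laurent_term (laurent_coef p a) a.
Proof. exact: monalgE. Qed.

Let mul_suml I (r : seq I) (F : I -> L) q :
  laurent_mul (\sum_(i <- r) F i) q = \sum_(i <- r) laurent_mul (F i) q.
Proof. exact: (big_morph (laurent_mul^~ q) (fun _ _ => mulDl _ _ _) (mul0 _)). Qed.

Let mul_sumr I (r : seq I) (F : I -> L) q :
  laurent_mul q (\sum_(i <- r) F i) = \sum_(i <- r) laurent_mul q (F i).
Proof. by rewrite mulC mul_suml; apply/eq_bigr => i _; rewrite mulC. Qed.

Let mulA : associative laurent_mul.
Proof.
move=> p q r; rewrite (termE p) !mul_suml; apply/eq_bigr => a _.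
rewrite (termE q) mul_sumr !mul_suml mul_sumr; apply/eq_bigr => b _.
rewrite (termE r) !mul_sumr; apply/eq_bigr => c _.
by rewrite !mulTT mulrA addrA.
Qed.

Let mul1 : left_id (laurent_term 1 0) laurent_mul.
Proof.
move=> p; rewrite {1}(termE p) mul_sumr [RHS]termE; apply/eq_bigr => a _.
by rewrite mulTT mul1r add0r.
Qed.

Let one_neq0 : laurent_term 1 0 != 0.
Proof. by rewrite monalgU_eq0 oner_eq0. Qed.

HB.instance Definition _ := GRing.Zmodule_isComNzRing.Build L
  mulA mulC mul1 mulDl one_neq0.

Let scaleE c p : c *: p = laurent_mul (laurent_term c 0) p.
Proof.
rewrite {2}(termE p) mul_sumr {1}(termE p) scaler_sumr; apply/eq_bigr => a _.
by rewrite mulTT add0r; exact: scaleT.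
Qed.

Let scaleAl c p q : c *: (p * q) = c *: p * q.
Proof. by rewrite !scaleE; exact: mulA. Qed.

HB.instance Definition _ := GRing.Lmodule_isLalgebra.Build K L scaleAl.
HB.instance Definition _ := GRing.Lalgebra_isComAlgebra.Build K L.

Definition laurent_eval (z : 'rV[K]_n) p : K :=
  \sum_(a <- monalg.msupp p) laurent_coef p a * \prod_(i < n) z ord0 i ^ a ord0 i.

(* The inclusion K[x_1, ..., x_n] -> K[x_1^{+-1}, ..., x_n^{+-1}]. *)
Definition laurent_of_mpoly (p : mpoly n K) : L :=
  \sum_(m <- mpoly.msupp p)
    laurent_term (mpoly.mcoeff m p) (\row_i (fun_of_multinom m i)%:Z).

End LaurentRing.

Definition laurent_conj (n : nat) (C : numClosedFieldType) (p : laurent n C) :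
    laurent n C :=
  \sum_(a <- monalg.msupp p) laurent_term (Num.conj (laurent_coef p a)) (- a).

Definition mpoly_eval (n : nat) (K : fieldType) (x : 'rV[K]_n)
  (p : mpoly n K) : K := meval (fun i => x ord0 i) p.

Local Open Scope classical_set_scope.

Section LinearAlgebra.
Context (K : fieldType).

Definition is_subspace (V : lmodType K) (U : set V) : Prop :=
  U 0 /\ forall (c : K) u v, U u -> U v -> U (c *: u + v).

Definition is_basis (V : lmodType K) (U : set V) (m : nat) (b : 'I_m -> V) :
    Prop :=
  (forall c : 'I_m -> K, \sum_i c i *: b i = 0 -> forall i, c i = 0) /\
  U = [set v | exists c : 'I_m -> K, v = \sum_i c i *: b i].

Definition finite_dimensional (V : lmodType K) (U : set V) : Prop :=
  exists (m : nat) (b : 'I_m -> V), is_basis U b.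

Definition is_filtration (A : algType K) (F : nat -> set A) : Prop :=
  [/\ forall d, is_subspace (F d),
      forall d e, (d <= e)%N -> F d `<=` F e,
      \bigcup_d F d = [set: A],
      F 0%N 1
    & forall d e p q, F d p -> F e q -> F (d + e)%N (p * q)].

Definition gram_matrix (S T : Type) (s : T -> S -> K) (m' m : nat)
  (BL : 'I_m' -> T) (BR : 'I_m -> S) : 'M[K]_(m', m) :=
  \matrix_(i, j) s (BL i) (BR j).

(* The kernel of H, regarded as a subspace of the span of b via the basis b. *)
Definition kernel_in (V : lmodType K) (m' m : nat) (H : 'M[K]_(m', m))
  (b : 'I_m -> V) : set V :=
  [set v | exists c : 'cV[K]_m, H *m c = 0 /\ v = \sum_j c j ord0 *: b j].

End LinearAlgebra.

Definition borel (T : ptopologicalType) := g_sigma_algebraType (@open T).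

(* mathcomp-analysis has no integral against a charge: take the difference of
   the integrals against the two parts of the Jordan decomposition. *)
Definition charge_integral d (T : measurableType d) (R : realType)
  (nu : {charge set T -> \bar R}) (f : T -> R) : R :=
  let: exist P hP := cid (Hahn_decomposition nu) in
  let: exist N hPN := cid hP in
  (\int[jordan_pos hPN]_x f x - \int[jordan_neg hPN]_x f x)%R.

(* R[i] declared as a numClosedFieldType, from which it gets its topology. *)
Definition Cplx (R : realType) : numClosedFieldType := R[i]%C.

Record complex_measure d (T : measurableType d) (R : realType) :=
  ComplexMeasure {
    re_measure : {charge set T -> \bar R};
    im_measure : {charge set T -> \bar R} }.

Definition complex_integral d (T : measurableType d) (R : realType)
  (mu : complex_measure T R) (f : T -> Cplx R) : Cplx R :=
  let re x := complex.Re (f x) in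
  let im x := complex.Im (f x) in
  Complex
    (charge_integral (re_measure mu) re - charge_integral (im_measure mu) im)
    (charge_integral (im_measure mu) re + charge_integral (re_measure mu) im).

Section MomentData.
Context (T : topologicalType) (K : numFieldType).

(* C^0_c(U), extended by zero, for U open in T. *)
Definition Cc (U : set T) : set (T -> K) :=
  [set f | [/\ continuous f, compact (closure [set x | f x != 0])
             & closure [set x | f x != 0] `<=` U]].

(* The support of a measure given as a functional on C^0_c(T); the restriction
   of the functional to an open set U is its restriction to C^0_c(U). *)
Definition measure_supp (I : (T -> K) -> K) : set T :=
  [set xi | forall U : set T, open U -> U xi -> exists2 f, Cc U f & I f != 0].

Definition vanishing_ideal (L : Type) (ev : T -> L -> K) (X : set T) : set L :=
  [set p | forall xi, X xi -> ev xi p = 0].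

Definition moment_functional (L : Type) (ev : T -> L -> K)
  (I : (T -> K) -> K) (p : L) : K := I (fun x => ev x p).

Definition moment_form (L : pzRingType) (circ : L -> L) (sigma : L -> K)
  (q p : L) : K := sigma (circ q * p).

End MomentData.

Definition torus (n : nat) (R : realType) : set 'rV[Cplx R]_n :=
  [set z | forall i, `|z ord0 i| = 1].

Arguments torus : clear implicits.

Definition torus_type (n : nat) (R : realType) : Type := set_type (torus n R).

Section TorusType.
Context (n : nat) (R : realType).

HB.instance Definition _ := Topological.on (torus_type n R).

Let one_torus : const_mx 1 \in torus n R.
Proof. by apply/mem_set => i; rewrite mxE normr1. Qed.

HB.instance Definition _ :=
  isPointed.Build (torus_type n R) (exist _ (const_mx 1) one_torus).

Definition torus_eval (z : torus_type n R) (p : laurent n (Cplx R)) : Cplx R :=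
  laurent_eval (set_val z) p.

End TorusType.

(* Main.v *)
Require Import Defs.
From mathcomp Require Import all_boot all_order all_algebra finmap.
From mathcomp Require Import all_classical all_reals all_analysis.
From mathcomp Require Import measurable_realfun complex.
From mathcomp Require Import -(notations) mpoly.
From mathcomp Require Import -(notations) monalg.
From mathcomp Require Import ring lra.
Import Order.TTheory GRing.Theory Num.Theory numFieldNormedType.Exports.
Local Open Scope classical_set_scope.
Local Open Scope ring_scope.

Set Implicit Arguments.
Unset Strict Implicit.
Unset Printing Implicit Defensive.

(** For fixed d the kernels of H_{d',d} decrease as d' grows and lie in one
    space of finite dimension, so they are eventually equal to their
    intersection, the set of those p in R_{<= d} with sigma(q^o p) = 0 for all
    q in L ([kernel_in_eventually]).  It remains to see that this orthogonality
    means that p vanishes on the support S of mu.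

    First, mu is null on the complement of S ([compl_support_null]), so that all
    polynomials are integrable, integration is linear on them, and
    sigma(q^o p) = 0 whenever p vanishes on S.

    Conversely let p be orthogonal to all of L.  Replacing q by f p, with f in
    the algebra A of real polynomials (real trigonometric polynomials on the
    torus), shows that the integral of f |p|^2 vanishes for all f in A, for mu or
    for both the real and the imaginary part of mu.  Then mu is null on the open
    set where p does not vanish ([null_set_of_orthogonal]), and this set contains
    no point of S.

    The facts about measures thus rest on one lemma: if w >= 0 is continuous,
    and the integral of f w vanishes for all f in a large enough algebra A, then
    the charge is null on the set where w is positive.  Instead of approximating
    continuous functions uniformly, its proof approximates indicators: for f in A
    with |f| <= 1 on a compact set, iterating s |-> s(3 - s^2)/2 on f converges
    pointwise and boundedly to the sign of f.  By dominated convergence w has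
    integral 0 over the set where f is positive; such sets and their
    intersections form a pi-system which generates the Borel sets, so w has
    integral 0 over every Borel set, and a Hahn decomposition concludes.  The
    lemma is used twice: with A the polynomials and w = |p|^2 as above, and with
    A all continuous functions and w a bump, for the complement of S. *)

(** * Stabilization of the kernels *)

Section KernelStabilization.
Context (K : fieldType) (U V : lmodType K) (s : U -> V -> K).
Hypothesis s_linear : forall w c v1 v2, s w (c *: v1 + v2) = c * s w v1 + s w v2.
Hypothesis s_null : forall v, is_subspace [set w | s w v = 0].

Let s_sum w m (c : 'I_m -> K) (b : 'I_m -> V) :
  s w (\sum_j c j *: b j) = \sum_j c j * s w (b j).
Proof.
have s0 : s w 0 = 0.
  by have := s_linear w (-1) 0 0; rewrite scaler0 addr0 mulN1r addNr.
apply: (big_rec2 (fun x y => s w x = y)) => // j y x _ <-.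
by rewrite s_linear.
Qed.

Lemma gram_mulmx_eq0P (F : set U) m' (a : 'I_m' -> U) m (b : 'I_m -> V)
    (c : 'cV[K]_m) : is_basis F a ->
  gram_matrix s a b *m c = 0 <->
  forall w, F w -> s w (\sum_j c j ord0 *: b j) = 0.
Proof.
move=> [_ FE].
have entry i : (gram_matrix s a b *m c) i ord0 = s (a i) (\sum_j c j ord0 *: b j).
  by rewrite s_sum mxE; apply: eq_bigr => j _; rewrite !mxE mulrC.
split=> [Hc0 w|sF0].
  rewrite FE => -[e ->]; have [null0 nullD] := s_null (\sum_j c j ord0 *: b j).
  apply: (big_ind (fun w => s w _ = 0)) => // [x y x0 y0|i _].
    by have := nullD 1 x y x0 y0; rewrite /= scale1r.
  by rewrite -[X in s X _]addr0; apply: nullD => //=; rewrite -entry Hc0 mxE.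
apply/colP => i; rewrite entry mxE; apply: sF0; rewrite FE.
exists (fun j => (j == i)%:R); rewrite (bigD1 i)//= eqxx scale1r big1 ?addr0//.
by move=> j /negPf ->; rewrite scale0r.
Qed.

(** The kernels decrease with the row level and live in one space of finite
    dimension, so they are constant from any level at which the rank of the
    kernel is minimal; there they consist of the vectors orthogonal to
    everything. *)
Lemma kernel_in_eventually (F : nat -> set U) (dF : nat -> nat)
    (a : forall d, 'I_(dF d) -> U) (E : set V) m (b : 'I_m -> V) :
  (forall d e, (d <= e)%N -> F d `<=` F e) -> \bigcup_d F d = [set: U] ->
  (forall d, is_basis (F d) (a d)) -> is_basis E b ->
  \forall d \near \oo,
    kernel_in (gram_matrix s (a d) b) b = [set v | E v /\ forall w, s w v = 0].
Proof.
move=> F_homo F_cover a_basis [_ EE].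
pose H d := gram_matrix s (a d) b.
pose W d := kermx (H d)^T.
have W_col d (c : 'cV[K]_m) : (c^T <= W d)%MS = (H d *m c == 0).
  by rewrite -(inj_eq (@trmx_inj _ _ _)) trmx_mul trmx0; apply/sub_kermxP/eqP.
have W_anti d e : (d <= e)%N -> (W e <= W d)%MS.
  move=> de; apply/row_subP => i; rewrite -[row i _]trmxK W_col.
  apply/eqP/(gram_mulmx_eq0P _ _ (a_basis d)) => w /(F_homo _ _ de).
  move: w; apply/(gram_mulmx_eq0P _ _ (a_basis e)); apply/eqP.
  by rewrite -W_col trmxK row_sub.
have [D D_min] : exists D, forall d, (\rank (W D) <= \rank (W d))%N.
  have ex_rank : exists r, `[< exists d, r = \rank (W d) >].
    by exists (\rank (W 0%N)); apply/asboolP; exists 0%N.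
  case: (ex_minnP ex_rank) => r /asboolP[D rD] r_min; exists D => d.
  by rewrite -rD; apply: r_min; apply/asboolP; exists d.
have W_const d : (D <= d)%N -> (W D <= W d)%MS.
  move=> Dd; have := mxrank_leqif_eq (W_anti _ _ Dd).
  by move=> [WdD]; rewrite eqn_leq WdD D_min => /esym/andP[].
exists D => // d /= Dd; apply/seteqP; split=> v /=.
  move=> [c [Hc0 ->]]; split; first by rewrite EE; exists (fun j => c j ord0).
  move=> w; have [e _ Few] : (\bigcup_d F d) w by rewrite F_cover.
  move: w Few; apply/(gram_mulmx_eq0P _ _ (a_basis e)); apply/eqP.
  rewrite -W_col; apply: (submx_trans _ (W_anti _ (maxn D e) (leq_maxr _ _))).
  apply: (submx_trans _ (W_const _ (leq_maxl _ _))).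
  by apply: (submx_trans _ (W_anti _ _ Dd)); rewrite W_col Hc0.
move=> []; rewrite EE => -[c ->] v_null; exists (\col_j c j); split.
  apply/(gram_mulmx_eq0P _ _ (a_basis d)) => w _.
  by under eq_bigr do rewrite mxE.
by under [RHS]eq_bigr do rewrite mxE.
Qed.

End KernelStabilization.

(** * Polynomial approximation of the sign *)

Section SignApproximation.
Context (R : realType).
Implicit Type s : R.

(** The fixed points are -1, 0 and 1; on [-1, 1] the iterates tend to the sign
    of the starting point. *)
Definition sign_step s : R := s * (3 - s ^+ 2) / 2.

(** Polynomials in s that tend to 1 if 0 < s <= 1 and to 0 if -1 <= s <= 0. *)
Definition pos_approx m s : R :=
  (iter m sign_step s ^+ 2 + iter m sign_step s) / 2.

Lemma sign_step_itv s : `|s| <= 1 -> `|sign_step s| <= 1.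
Proof.
rewrite /sign_step !ler_norml => /andP[s1 s2]; apply/andP; split.
  rewrite -subr_ge0 (_ : _ - _ = (1 + s) ^+ 2 * (2 - s) / 2); last by field.
  by apply: divr_ge0 => //; apply: mulr_ge0; [exact: sqr_ge0|lra].
rewrite -subr_ge0 (_ : _ - _ = (1 - s) ^+ 2 * (2 + s) / 2); last by field.
by apply: divr_ge0 => //; apply: mulr_ge0; [exact: sqr_ge0|lra].
Qed.

Lemma iter_sign_step_itv m s : `|s| <= 1 -> `|iter m sign_step s| <= 1.
Proof. by move=> s1; elim: m => //= m; exact: sign_step_itv. Qed.

Lemma pos_approx_itv m s : `|s| <= 1 -> `|pos_approx m s| <= 1.
Proof.
move=> /(iter_sign_step_itv m); rewrite /pos_approx.
move: (iter _ _ _) => t; rewrite !ler_norml => /andP[t1 t2].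
apply/andP; split; rewrite -subr_ge0; nra.
Qed.

Lemma iter_sign_stepN m s : iter m sign_step (- s) = - iter m sign_step s.
Proof.
by elim: m => //= m ->; rewrite /sign_step sqrrN !mulNr.
Qed.

(** On ]0, 1] one step multiplies the distance to 1 by
    (1 - s)(2 + s)/2 = 1 - (s + s^2)/2, and s only increases: the convergence
    is geometric. *)
Lemma iter_sign_step_bound m s : 0 < s <= 1 ->
  s <= iter m sign_step s <= 1 /\
  1 - iter m sign_step s <= (1 - s / 2) ^+ m.
Proof.
move=> /andP[s0 s1]; elim: m => [|m [/andP[]]].
  by rewrite /= lexx s1; split=> //; rewrite expr0; lra.
rewrite iterS exprS; move: (iter _ _ _) => t st t1 tm; split.
  rewrite /sign_step; apply/andP; split; last first.
    have : `|sign_step t| <= 1 by apply: sign_step_itv; rewrite ler_norml; lra.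
    by rewrite ler_norml => /andP[].
  apply: (le_trans st); rewrite -subr_ge0.
  rewrite (_ : _ - _ = t * ((1 - t) * (1 + t)) / 2); last by field.
  by apply: divr_ge0 => //; apply: mulr_ge0; [lra|apply: mulr_ge0; lra].
have -> : 1 - sign_step t = (1 - (t + t ^+ 2) / 2) * (1 - t).
  by rewrite /sign_step; field.
apply: ler_pM => //; [by nra|by lra|].
by have := sqr_ge0 t; lra.
Qed.

Lemma pos_approx_cvg s : `|s| <= 1 ->
  pos_approx m s @[m --> \oo] --> (if 0 < s then 1 else 0 : R).
Proof.
move=> s1.
have iter_cvg t : 0 < t <= 1 -> iter m sign_step t @[m --> \oo] --> (1 : R).
  move=> t01; have /andP[t0 t1] := t01.
  have geo : (1 - t / 2) ^+ m @[m --> \oo] --> (0 : R).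
    by apply: cvg_expr; rewrite ger0_norm; lra.
  have : 1 - (1 - t / 2) ^+ m @[m --> \oo] --> (1 - 0 : R).
    by apply: cvgB geo; exact: cvg_cst.
  rewrite subr0 => low; apply: squeeze_cvgr low (cvg_cst (1 : R)).
  apply: nearW => m; have [/andP[_ ->]] := iter_sign_step_bound m t01.
  by rewrite andbT; lra.
have pos_cvg (l : R) : iter m sign_step s @[m --> \oo] --> l ->
    pos_approx m s @[m --> \oo] --> (l ^+ 2 + l) / 2.
  move=> h; apply: cvgM; last exact: cvg_cst.
  by apply: cvgD (h); exact: (cvgM h h).
move: s1; rewrite ler_norml => /andP[sN1 s1].
have [s0|s0|s0] := ltrgt0P s.
- have -> : (1 : R) = (1 ^+ 2 + 1) / 2 by field.
  by apply/pos_cvg/iter_cvg; rewrite s0.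
- have -> : (0 : R) = ((-1) ^+ 2 + (-1)) / 2 by field.
  apply/pos_cvg; rewrite -[s]opprK; under eq_fun do rewrite iter_sign_stepN.
  by apply: cvgN; apply: iter_cvg; lra.
- have -> : (0 : R) = (0 ^+ 2 + 0) / 2 by field.
  apply/pos_cvg; rewrite s0 [X in X @ _ --> _](_ : _ = cst 0).
    exact: cvg_cst.
  by apply/funext => m /=; elim: m => //= m ->; rewrite /sign_step !mul0r.
Qed.

End SignApproximation.

(** * Function algebras and bumps *)

Section FunctionAlgebras.
Context (K : numFieldType).

Definition function_algebra (T : Type) (A : set (T -> K)) : Prop :=
  [/\ forall c, A (fun=> c),
      forall f g, A f -> A g -> A (fun x => f x + g x)
    & forall f g, A f -> A g -> A (fun x => f x * g x)].

Lemma function_algebra_sum (T : Type) (A : set (T -> K)) I (r : seq I)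
    (f : I -> T -> K) :
  function_algebra A -> (forall i, A (f i)) -> A (fun x => \sum_(i <- r) f i x).
Proof.
move=> [cA DA _] Af; elim: r => [|i r IHr].
  by under eq_fun do rewrite big_nil; exact: cA.
by under eq_fun do rewrite big_cons; exact: DA.
Qed.

Lemma function_algebra_exp (T : Type) (A : set (T -> K)) (f : T -> K) k :
  function_algebra A -> A f -> A (fun x => f x ^+ k).
Proof.
move=> [cA _ MA] Af; elim: k => [|k IHk]; first exact: cA.
by under eq_fun do rewrite exprS; exact: MA.
Qed.

Lemma function_algebra_prod (T : Type) (A : set (T -> K)) I (r : seq I)
    (f : I -> T -> K) :
  function_algebra A -> (forall i, A (f i)) -> A (fun x => \prod_(i <- r) f i x).
Proof.
move=> [cA _ MA] Af; elim: r => [|i r IHr].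
  by under eq_fun do rewrite big_nil; exact: cA.
by under eq_fun do rewrite big_cons; exact: MA.
Qed.

Lemma function_algebra_continuous (T : topologicalType) :
  function_algebra [set f : T -> K | continuous f].
Proof.
split=> [c|f g fc gc|f g fc gc] /= x; first exact: cst_continuous.
  by apply: cvgD; [exact: fc|exact: gc].
by apply: cvgM; [exact: fc|exact: gc].
Qed.

End FunctionAlgebras.

Section Bumps.
Context (R : realType).

(** The coordinates of a closed embedding of T into the Euclidean space R^J:
    they determine the topology, and the inverse images of boxes are compact. *)
Definition coordinates (T : topologicalType) (J : finType) (u : J -> T -> R) :
    Prop :=
  [/\ forall j, continuous (u j),
      forall x U, nbhs x U ->
        exists2 e, 0 < e & forall y, (forall j, `|u j y - u j x| <= e) -> U y
    & forall M, compact [set y | forall j, `|u j y| <= M]].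

Context (T : topologicalType) (J : finType) (u : J -> T -> R).
Implicit Types (c : {ffun J -> rat}) (r : rat).

(** Positive exactly on an open ball in the coordinates, which have rational
    centre and radius in order that the balls be countably many. *)
Definition bump c r x : R := ratr r ^+ 2 - \sum_j (u j x - ratr (c j)) ^+ 2.

Lemma bump_algebra (A : set (T -> R)) c r :
  function_algebra A -> (forall j, A (u j)) -> A (bump c r).
Proof.
move=> algA Au; have [cA DA MA] := algA.
have -> : bump c r = (fun x => ratr r ^+ 2 +
    (-1) * \sum_j (u j x + - ratr (c j)) * (u j x + - ratr (c j))).
  by apply/funext => x; rewrite mulN1r.
apply: (DA); first exact: cA.
apply: (MA); first exact: cA.
by apply: function_algebra_sum => // j; apply: MA; apply: (DA) => //; exact: cA.
Qed.

Hypothesis u_coord : coordinates u.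

Lemma bump_continuous c r : continuous (bump c r).
Proof.
by case: u_coord => uc _ _; apply: bump_algebra (function_algebra_continuous R T) _.
Qed.

Lemma bump_ge0_dist c r x j : 0 <= bump c r x -> `|u j x - ratr (c j)| <= `|ratr r|.
Proof.
rewrite subr_ge0 (bigD1 j)//= => ur; rewrite -ler_sqr ?nnegrE//.
rewrite !real_normK ?num_real//; apply: le_trans ur.
by rewrite lerDl; apply: sumr_ge0 => i _; exact: sqr_ge0.
Qed.

Lemma bump_compact c r : compact [set x | 0 <= bump c r x].
Proof.
have [_ _ box_compact] := u_coord.
pose M := `|ratr r : R| + \sum_j `|ratr (c j)|.
apply: (subclosed_compact _ (box_compact M)).
  apply: (@preimage_closed _ _ (bump c r) [set t | 0 <= t]) (@closed_ge _ 0).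
  by move=> x _; exact: bump_continuous.
move=> x /= x_bump j; rewrite -[u j x](subrK (ratr (c j))).
apply: (le_trans (ler_normD _ _)); apply: lerD; first exact: bump_ge0_dist.
by rewrite (bigD1 j)//= lerDl; apply: sumr_ge0.
Qed.

Lemma bump_closure c r :
  closure [set x | 0 < bump c r x] `<=` [set x | 0 <= bump c r x].
Proof.
have cl : closed [set x | 0 <= bump c r x].
  apply: (@preimage_closed _ _ (bump c r) [set t | 0 <= t]) (@closed_ge _ 0).
  by move=> x _; exact: bump_continuous.
rewrite [X in _ `<=` X](closure_id _).1//.
by apply: closure_subset => x /= /ltW.
Qed.

Lemma bump_basis x (U : set T) : nbhs x U ->
  exists c r, 0 < bump c r x /\ [set y | 0 <= bump c r y] `<=` U.
Proof.
move=> xU; have [_ /(_ x U xU)[e e0 eU] _] := u_coord.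
have /rat_in_itvoo[r] : 0 < e / 2 by rewrite divr_gt0.
rewrite in_itv/= => /andP[r0 re].
(* This makes #|J| squared deviations sum to less than r^2. *)
pose t : R := ratr r / #|J|.+1%:R.
have t0 : 0 < t by rewrite divr_gt0.
have : forall j, exists q : rat, `|u j x - ratr q| <= t.
  move=> j; have /rat_in_itvoo[q] : u j x - t < u j x + t by lra.
  by rewrite in_itv/= => qt; exists q; rewrite ler_norml; lra.
move=> /choice[c ct]; exists [ffun j => c j], r; split.
  rewrite subr_gt0; apply: (@le_lt_trans _ _ (\sum_(j : J) t ^+ 2)).
    apply: ler_sum => j _; rewrite ffunE -[leLHS]real_normK ?num_real//.
    by rewrite ler_sqr ?nnegrE// ltW.
  rewrite sumr_const -mulr_natl /t expr_div_n.
  rewrite mulrCA gtr_pMr ?exprn_gt0// ltr_pdivrMr ?exprn_gt0// mul1r.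
  by rewrite -natrX ltr_nat expnS expn1 mulSn leq_addr.
move=> y /= y_bump; apply: eU => j.
have := bump_ge0_dist j y_bump; rewrite ffunE (gtr0_norm r0).
have := ct j; rewrite !ler_norml.
have : t <= ratr r by rewrite ler_pdivrMr// ler_peMr ?ler1n// ltW.
by move=> *; lra.
Qed.

End Bumps.

(** * Charges and their Jordan decompositions *)

Section ChargeFacts.
Context d (T : measurableType d) (R : realType).
Implicit Types nu : {charge set T -> \bar R}.

(** The uniqueness theorem for finite measures carries over to charges because
    the sets on which they agree form a Dynkin system. *)
Lemma charge_unique (G : set (set T)) (nu1 nu2 : {charge set T -> \bar R}) :
  measurable = <<s G >> -> setI_closed G -> G setT ->
  (forall A, G A -> nu1 A = nu2 A) -> forall A, measurable A -> nu1 A = nu2 A.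
Proof.
move=> mG GI GT G12 A; rewrite mG -setI_closed_g_dynkin_g_sigma_algebra// => GA.
suff : [set A | measurable A /\ nu1 A = nu2 A] A by case.
move: A GA; apply: smallest_sub; last first.
  by move=> A GA; split; [rewrite mG; exact: sub_sigma_algebra|exact: G12].
split; first by split; [exact: measurableT|exact: G12].
  move=> A [mA eA]; split; first exact: measurableC.
  by rewrite -setTD !chargeD// !setTI eA G12.
move=> F tF GF; have mF i : measurable (F i) by have [] := GF i.
have mUF : measurable (\bigcup_k F k) by exact: bigcupT_measurable.
split => //.
have c1 := charge_semi_sigma_additive (s := nu1) F mF tF mUF.
have c2 := charge_semi_sigma_additive (s := nu2) F mF tF mUF.
rewrite -(cvg_lim _ c1)// -(cvg_lim _ c2)//; apply/congr_lim/funext => n.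
by apply: eq_bigr => i _; have [] := GF i.
Qed.

Lemma jordan_pos_setI nu P N (h : hahn_decomposition nu P N) B :
  measurable B -> jordan_pos h B = nu (B `&` P).
Proof. by move=> mB; rewrite jordan_posE cjordan_posE /crestr0 mem_set. Qed.

Lemma jordan_neg_setI nu P N (h : hahn_decomposition nu P N) B :
  measurable B -> (jordan_neg h B = - nu (B `&` N))%E.
Proof. by move=> mB; rewrite jordan_negE cjordan_negE /crestr0 mem_set. Qed.

Lemma hahn_measurable nu P N :
  hahn_decomposition nu P N -> measurable P /\ measurable N.
Proof. by case=> -[? _] [? _]. Qed.

Lemma null_set_jordan nu P N (h : hahn_decomposition nu P N) A :
  measurable A ->
  nu.-null_set A <-> jordan_pos h A = 0%E /\ jordan_neg h A = 0%E.
Proof.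
have [mP mN] := hahn_measurable h; move=> mA; split=> [A0|[p0 n0] B mB BA].
  rewrite jordan_pos_setI// jordan_neg_setI// !A0 ?oppe0//; exact: measurableI.
rewrite (jordan_decomp h mB) /cadd/= cscaleN1.
rewrite ((measure0_null_setP _ mA).2 p0 B mB BA).
rewrite add0e; apply/eqP; rewrite oppe_eq0; apply/eqP.
exact: (measure0_null_setP _ mA).2 n0 B mB BA.
Qed.

Lemma charge_integral_jordan nu : exists P N (h : hahn_decomposition nu P N),
  forall f, charge_integral nu f =
            \int[jordan_pos h]_x f x - \int[jordan_neg h]_x f x.
Proof.
rewrite /charge_integral; case: cid => P hP; case: cid => N h.
by exists P, N, h.
Qed.

Lemma ae_eq_integrable (m : {measure set T -> \bar R}) (f g : T -> \bar R) :
  measurable_fun setT g -> ae_eq m setT f g ->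
  m.-integrable setT f -> m.-integrable setT g.
Proof.
move=> mg fg /integrableP[mf foo]; apply/integrableP; split=> //.
rewrite (_ : (\int[m]_x `|g x|)%E = (\int[m]_x `|f x|)%E)//.
apply: ae_eq_integral => //.
- exact: measurableT_comp.
- exact: measurableT_comp.
- by apply: filterS fg => x fg /fg ->.
Qed.

Lemma ae_eq_off_null_set (m : {measure set T -> \bar R}) (f g : T -> \bar R) A :
  measurable A -> m A = 0%E -> (forall x, ~ A x -> f x = g x) ->
  ae_eq m setT f g.
Proof.
move=> mA mA0 fg; exists A; split=> // x; apply: contra_notP => /fg fgx _.
exact: fgx.
Qed.

(** Meant for the positive or negative part m of a charge and its Hahn
    decomposition P, N: one of these sets is m-null; the other is null for the
    opposite part, and over it the integrals of v against both parts agree. *)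
Lemma null_density (m : {measure set T -> \bar R}) P N (v : T -> R) :
  measurable P -> measurable N -> P `|` N = setT -> P `&` N = set0 ->
  measurable_fun setT v -> (forall x, 0 <= v x) ->
  (\int[m]_(x in P) (v x)%:E = 0)%E -> (\int[m]_(x in N) (v x)%:E = 0)%E ->
  m [set x | 0 < v x] = 0%E.
Proof.
move=> mP mN PN PIN mv v0 vP vN.
have : (\int[m]_x `|(v x)%:E| = 0)%E.
  under eq_integral do rewrite gee0_abs ?lee_fin//.
  rewrite -PN ge0_integral_setU//.
  - by rewrite vP vN adde0.
  - by rewrite PN; exact/measurable_EFinP.
  - by move=> x _; rewrite lee_fin.
  - exact/disj_set2P.
have mEv : measurable_fun setT (EFin \o v) by exact/measurable_EFinP.
move/(ae_eq_integral_abs m measurableT mEv).1 => [M [mM M0 MN]].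
apply/eqP; rewrite eq_le measure_ge0 andbT -M0; apply: le_measure.
- rewrite inE (_ : [set x | _] = v @^-1` `]0, +oo[%classic).
    by rewrite -[X in measurable X]setTI; exact: mv.
  by apply/seteqP; split=> x /=; rewrite in_itv/= andbT.
- by rewrite inE.
- by move=> x /= vx; apply: MN => /= /(_ I) [] vx0; rewrite vx0 ltxx in vx.
Qed.

End ChargeFacts.

(** * Charges orthogonal to an algebra of functions *)

Section BorelCharges.
Context (R : realType) (T : ptopologicalType).
Implicit Types (f g w : T -> R) (K : set T) (A : set (T -> R))
  (nu : {charge set (borel T) -> \bar R}).

Lemma open_borel (U : set T) : open U -> measurable (U : set (borel T)).
Proof. exact: sub_sigma_algebra. Qed.

Lemma closed_borel (F : set T) : closed F -> measurable (F : set (borel T)).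
Proof.
move=> cF; have /open_borel/measurableC := closed_openC cF.
by rewrite setCK.
Qed.

Lemma continuous_borel f :
  continuous f -> measurable_fun setT (f : borel T -> R).
Proof.
move=> /continuousP cf; apply: (measurability _ (RGenOpens.measurableE R)).
move=> _ [_ [a [b ->] <-]]; rewrite setTI.
by apply: open_borel; apply: cf; exact: interval_open.
Qed.

Lemma continuous_bounded_on f K : continuous f -> compact K ->
  exists2 M, 0 < M & forall x, K x -> `|f x| <= M.
Proof.
move=> cf cK.
have /compact_bounded[M [_ MP]] : compact (f @` K).
  by apply: continuous_compact => //; exact: continuous_subspaceT.
exists (`|M| + 1) => [|x Kx]; first by rewrite ltr_wpDl.
apply: (MP (`|M| + 1)); last by exists x.
by rewrite (le_lt_trans (ler_norm M))// ltrDl.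
Qed.

(** Open sets whose indicator is on K a pointwise limit of members of A
    bounded by 1.  If the integrals of f w vanish for all f in A, then by
    dominated convergence so does the integral of w over such a set. *)
Definition approximable A K : set (set T) :=
  [set C | open C /\ exists g : nat -> T -> R,
    [/\ forall m, A (g m), forall m x, K x -> `|g m x| <= 1
      & forall x, K x -> g m x @[m --> \oo] --> (\1_C x : R)]].

Lemma approximable_setT A K : function_algebra A -> approximable A K setT.
Proof.
move=> [cA _ _]; split; first exact: openT.
exists (fun _ _ => 1); split=> [m|m x _|x _]; first exact: cA.
  by rewrite normr1.
by rewrite indicE in_setT; exact: cvg_cst.
Qed.

Lemma approximable_setI A K :
  function_algebra A -> setI_closed (approximable A K).
Proof.
move=> [_ _ MA] C D [oC [g [Ag g1 gC]]] [oD [h [Ah h1 hD]]].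
split; first exact: openI.
exists (fun m x => g m x * h m x); split=> [m|m x Kx|x Kx]; first exact: MA.
  by rewrite normrM mulr_ile1// ?g1// h1.
by rewrite indicI; apply: cvgM; [exact: gC|exact: hD].
Qed.

Lemma function_algebra_pos_approx A m f :
  function_algebra A -> A f -> A (fun x => pos_approx m (f x)).
Proof.
move=> [cA DA MA] Af.
have Aiter : A (fun x => iter m (@sign_step R) (f x)).
  elim: m => //= m IHm; rewrite /sign_step.
  apply: (MA _ (fun=> 2^-1)); last exact: cA.
  apply: (MA) => //; apply: (DA (fun=> 3)); first exact: cA.
  rewrite (_ : (fun _ => _) = fun x : T =>
      (-1) * (iter m (@sign_step R) (f x) * iter m (@sign_step R) (f x))).
    by apply: (MA); [exact: cA|exact: MA].
  by apply/funext => x; rewrite mulN1r.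
apply: (MA _ (fun=> 2^-1)); last exact: cA.
by apply: DA => //; exact: MA.
Qed.

Lemma approximable_pos A K f : function_algebra A -> A f -> continuous f ->
  compact K -> approximable A K [set x | 0 < f x].
Proof.
move=> algA Af cf cK; have [M M0 fM] := continuous_bounded_on cf cK.
have Mle x : K x -> `|f x / M| <= 1.
  by move=> Kx; rewrite normrM normfV (gtr0_norm M0) ler_pdivrMr// mul1r fM.
split; first by apply: (@open_comp _ _ f [set t | 0 < t]) (@open_gt _ 0).
have AfM : A (fun x => f x / M).
  by have [cA _ MA] := algA; apply: (MA _ (fun=> M^-1)) => //; exact: cA.
exists (fun m x => pos_approx m (f x / M)); split=> [m|m x Kx|x Kx].
- exact: function_algebra_pos_approx.
- exact/pos_approx_itv/Mle.
- have -> : (\1_[set y | 0 < f y] x : R) = if 0 < f x / M then 1 else 0.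
    rewrite pmulr_lgt0 ?invr_gt0// indicE.
    by case: ifPn => fx; [rewrite mem_set|rewrite memNset//=; exact/negP].
  exact/pos_approx_cvg/Mle.
Qed.

Context (J : finType) (u : J -> T -> R).
Hypothesis u_coord : coordinates u.

(** Every open set is a countable union of balls with rational centre and
    radius, and a ball is the set where a bump in A is positive. *)
Lemma borel_approximable A K : function_algebra A -> (forall j, A (u j)) ->
  compact K -> @measurable _ (borel T) = <<s approximable A K >>.
Proof.
move=> algA Au cK; apply/seteqP; split; last first.
  apply: smallest_sub; first exact: sigma_algebra_measurable.
  by move=> C [oC _]; exact: open_borel.
apply: smallest_sub; first exact: smallest_sigma_algebra.
move=> U oU.
have -> : U = \bigcup_(k in [set k : {ffun J -> rat} * rat |
    [set y | 0 <= bump u k.1 k.2 y] `<=` U]) [set x | 0 < bump u k.1 k.2 x].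
  apply/seteqP; split=> x; last by move=> [k kU /ltW xk]; exact: kU.
  move=> Ux; have [|c [r [xcr crU]]] := bump_basis u_coord (U := U) (x := x).
    exact: open_nbhs_nbhs.
  by exists (c, r).
rewrite bigcup_mkcond.
have cnt : countable [set: {ffun J -> rat} * rat] by exact: countableP.
pose GT : measurableType _ := g_sigma_algebraType (approximable A K).
apply: (@countable_bigcupT_measurable _ GT _ _ cnt) => k.
case: ifP => _; last exact: measurable0.
apply: sub_sigma_algebra; apply: approximable_pos => //.
  exact: bump_algebra.
exact: bump_continuous.
Qed.

Lemma restrict_ge0 K w : (forall x, 0 <= w x) -> forall x, 0 <= (w \_ K) x.
Proof. by move=> w0 x; rewrite patchE; case: ifP. Qed.

Lemma restrict_continuous_borel K w : closed K -> continuous w ->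
  measurable_fun setT (w \_ K : borel T -> R).
Proof.
move=> clK cw; apply/(measurable_restrict _ (closed_borel clK) measurableT).
by apply: measurable_funTS; exact: continuous_borel.
Qed.

Lemma continuous_restrict_integrable
    (m : {finite_measure set (borel T) -> \bar R}) K w g :
  compact K -> closed K -> continuous w ->
  measurable_fun setT (g : borel T -> R) -> (forall x, K x -> `|g x| <= 1) ->
  m.-integrable setT (EFin \o (fun x => g x * (w \_ K) x)).
Proof.
move=> cK clK cw mg g1; have [M M0 wM] := continuous_bounded_on cw cK.
apply: measurable_bounded_integrable => //.
- by rewrite ltey_eq fin_num_measure.
- apply: measurable_funM => //; exact: restrict_continuous_borel.
exists M; split; first exact: num_real.
move=> y My x _; rewrite /= patchE; case: ifPn => [/set_mem Kx|_].
  rewrite normrM (le_trans _ (ltW My))// -[M]mul1r ler_pM//; first exact: g1.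
  exact: wM.
by rewrite mulr0 normr0 (le_trans (ltW M0))// ltW.
Qed.

Lemma approximable_integral_cvg (m : {finite_measure set (borel T) -> \bar R})
    K w (C : set T) (g : nat -> T -> R) :
  compact K -> closed K -> continuous w -> open C ->
  (forall k, continuous (g k)) -> (forall k x, K x -> `|g k x| <= 1) ->
  (forall x, K x -> g k x @[k --> \oo] --> (\1_C x : R)) ->
  (\int[m]_x (g k x * (w \_ K) x)%:E)%E @[k --> \oo] -->
  (\int[m]_(x in C) ((w \_ K) x)%:E)%E.
Proof.
move=> cK clK cw oC cg g1 gC.
have mC := open_borel oC.
have m1C : measurable_fun setT (\1_C : borel T -> R) by exact: measurable_indic.
have C1 x : K x -> `|\1_C x : R| <= 1.
  by move=> _; rewrite indicE; case: (_ \in _); rewrite ?normr1// normr0.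
have integrable_gw (f : T -> R) : measurable_fun setT (f : borel T -> R) ->
    (forall x, K x -> `|f x| <= 1) ->
    m.-integrable setT (EFin \o (fun x => f x * (w \_ K) x)).
  exact: continuous_restrict_integrable.
have -> : (\int[m]_(x in C) ((w \_ K) x)%:E =
           \int[m]_x (\1_C x * (w \_ K) x)%:E)%E.
  rewrite integral_mkcond; apply: eq_integral => x _.
  by rewrite patchE indicE; case: ifP => _; rewrite ?mul1r ?mul0r.
have [] := @dominated_convergence _ _ _ m setT measurableT
  (fun k x => (g k x * (w \_ K) x)%:E) (fun x => (\1_C x * (w \_ K) x)%:E)
  (fun x => `|(w \_ K) x|%:E) => //.
- move=> k.
  by have /integrableP[] := integrable_gw _ (continuous_borel (cg k)) (g1 k).
- by have /integrableP[] := integrable_gw _ m1C C1.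
- apply: aeW => x _; apply: cvg_EFin; first exact: nearW.
  rewrite patchE; case: ifPn => [/set_mem Kx|_].
    by apply: cvgM; [exact: gC|exact: cvg_cst].
  rewrite [X in X @ _ --> _](_ : _ = cst 0); last first.
    by apply/funext => k /=; rewrite mulr0.
  by rewrite mulr0; exact: cvg_cst.
- rewrite (_ : (fun x => _) = EFin \o (Num.norm \o (fun x => 1 * (w \_ K) x))).
    apply: integrable_norm; apply: integrable_gw; first exact: measurable_cst.
    by move=> x _; rewrite normr1.
  by apply/funext => x /=; rewrite mul1r.
- apply: aeW => x k _; rewrite lee_fin patchE; case: ifPn => [/set_mem Kx|_].
    by rewrite normrM ler_piMl// g1.
  by rewrite mulr0 normr0.
Qed.

(** By dominated convergence w restricted to K has integral 0 over each
    approximable set; these sets form a pi-system generating the Borel sets, so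
    w has integral 0 over every Borel subset of K, in particular over its
    intersections with the two halves of a Hahn decomposition.  On each half the
    charge has constant sign, so w vanishes there almost everywhere. *)
Lemma null_set_of_orthogonal nu A K w :
  function_algebra A -> (forall j, A (u j)) -> A `<=` [set f | continuous f] ->
  compact K -> closed K -> continuous w -> (forall x, 0 <= w x) ->
  nu.-null_set ([set x | 0 < w x] `\` K) ->
  (forall q, A q -> charge_integral nu (fun x => q x * w x) = 0) ->
  nu.-null_set [set x | 0 < w x].
Proof.
move=> algA Au A_cont cK clK cw w0 nuZ orth.
have [P [N [h hE]]] := charge_integral_jordan nu.
have [mP mN] := hahn_measurable h; have [_ _ PN PIN] := h.
pose v := w \_ K; have v0 : forall x, 0 <= v x by exact: restrict_ge0.
have mv : measurable_fun setT (v : borel T -> R).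
  exact: restrict_continuous_borel.
have oW : open [set x | 0 < w x].
  by apply: (@open_comp _ _ w [set t | 0 < t]) (@open_gt _ 0).
have mW := open_borel oW.
pose Z : set (borel T) := [set x | 0 < w x] `\` K.
have mZ : measurable Z.
  by apply: measurableD; [exact: open_borel|exact: closed_borel].
have [pZ nZ] := (null_set_jordan h mZ).1 nuZ.
have intgv (m : {finite_measure set (borel T) -> \bar R}) g : continuous g ->
    (forall x, K x -> `|g x| <= 1) ->
    m.-integrable setT (EFin \o (fun x => g x * v x)).
  move=> cg; apply: continuous_restrict_integrable => //.
  exact: continuous_borel.
have intv (m : {finite_measure set (borel T) -> \bar R}) :
    m.-integrable setT (EFin \o v).
  have -> : EFin \o v = EFin \o (fun x => 1 * v x).
    by apply/funext => x; rewrite /= mul1r.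
  by apply: intgv => [x|x _]; [exact: cst_continuous|rewrite normr1].
have int_wv (m : {finite_measure set (borel T) -> \bar R}) (q : T -> R) :
    continuous q -> m Z = 0%E -> (\int[m]_x (q x * w x)%:E = \int[m]_x (q x * v x)%:E)%E.
  move=> cq mZ0; apply: ae_eq_integral => //.
  - apply/measurable_EFinP/measurable_funM; exact: continuous_borel.
  - by apply/measurable_EFinP/measurable_funM => //; exact: continuous_borel.
  apply: (ae_eq_off_null_set mZ mZ0) => x Zx; congr EFin; rewrite /v patchE.
  case: ifPn => // /negP xK; suff -> : w x = 0 by [].
  apply/eqP; rewrite eq_le w0 andbT leNgt; apply/negP => wx; apply: Zx.
  by split=> // /mem_set.
(* The two parts of the charge, with density v. *)
pose cp : {charge set (borel T) -> \bar R} :=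
  induced_charge (intv (jordan_pos h)).
pose cn : {charge set (borel T) -> \bar R} :=
  induced_charge (intv (jordan_neg h)).
have cpn B : measurable B -> cp B = cn B.
  apply: (charge_unique (borel_approximable algA Au cK)).
  - exact: approximable_setI.
  - exact: approximable_setT.
  move=> C [oC [g [Ag g1 gC]]].
  have cg k : continuous (g k) by exact: A_cont.
  have := approximable_integral_cvg (m := jordan_pos h) cK clK cw oC cg g1 gC.
  have := approximable_integral_cvg (m := jordan_neg h) cK clK cw oC cg g1 gC.
  rewrite [X in X @ _ --> _ -> _](_ : _ =
      (fun k => \int[jordan_pos h]_x (g k x * v x)%:E)%E).
    by move=> n_cvg p_cvg; exact: cvg_unique p_cvg n_cvg.
  apply/funext => k.
  have : \int[jordan_pos h]_x (g k x * w x) = \int[jordan_neg h]_x (g k x * w x).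
    by apply/eqP; rewrite -subr_eq0 -hE orth.
  rewrite /Rintegral !int_wv// => pn.
  have fin (m : {finite_measure set (borel T) -> \bar R}) :
      (\int[m]_x (g k x * v x)%:E)%E \is a fin_num.
    by apply: integrable_fin_num => //; apply: intgv => //; exact: g1.
  by rewrite -[LHS]fineK// -pn fineK.
have zero_int (m : {finite_measure set (borel T) -> \bar R}) (B : set (borel T)) :
    measurable B -> m B = 0%E -> (\int[m]_(x in B) (v x)%:E = 0)%E.
  move=> mB mB0; apply: null_set_integral => //.
  by apply/measurable_EFinP; exact: measurable_funTS.
have pN : jordan_pos h N = 0%E by rewrite jordan_pos_setI// setIC PIN charge0.
have nP : jordan_neg h P = 0%E by rewrite jordan_neg_setI// PIN charge0 oppe0.
have pv : jordan_pos h [set x | 0 < v x] = 0%E.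
  apply: (null_density mP mN) => //; last exact: zero_int.
  by rewrite -[LHS]/(cp P) cpn//; exact: zero_int.
have nv : jordan_neg h [set x | 0 < v x] = 0%E.
  apply: (null_density mP mN) => //; first exact: zero_int.
  by rewrite -[LHS]/(cn N) -cpn//; exact: zero_int.
have mV : measurable ([set x | 0 < v x] : set (borel T)).
  rewrite (_ : [set x | _] = v @^-1` `]0, +oo[%classic).
    by rewrite -[X in measurable X]setTI; exact: mv.
  by apply/seteqP; split=> x /=; rewrite in_itv/= andbT.
have WE : [set x | 0 < w x] = [set x | 0 < v x] `|` Z.
  apply/seteqP; split=> x /=.
    have [Kx wx|Kx wx] := pselect (K x); last by right.
    by left; rewrite /v patchE mem_set.
  by rewrite /v patchE => -[|[]//]; case: ifP => //; rewrite ltxx.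
apply/(null_set_jordan h mW); rewrite WE; split.
  exact: null_set_setU.
exact: null_set_setU.
Qed.

End BorelCharges.

(** * The complement of the support *)

Section SupportNull.
Context (R : realType) (T : ptopologicalType).
Implicit Types (f g w : T -> R) (K : set T)
  (nu : {charge set (borel T) -> \bar R}).

Lemma charge_integral_null nu Z f : measurable (Z : set (borel T)) ->
  nu.-null_set Z -> continuous f -> (forall x, ~ Z x -> f x = 0) ->
  charge_integral nu f = 0.
Proof.
move=> mZ nuZ cf fZ; have [P [N [h ->]]] := charge_integral_jordan nu.
have [pZ nZ] := (null_set_jordan h mZ).1 nuZ.
have int0 (m : {measure set (borel T) -> \bar R}) : m Z = 0%E ->
    \int[m]_x f x = 0.
  move=> mZ0; rewrite /Rintegral (_ : (\int[m]_x _ = \int[m]_x (cst 0) x)%E).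
    by rewrite integral0.
  apply: ae_eq_integral => //.
    by apply/measurable_EFinP; exact: continuous_borel.
  by apply: (ae_eq_off_null_set mZ mZ0) => x /fZ ->.
by rewrite !int0// subr0.
Qed.

(** Linearity needs integrability, which continuous functions have because
    the charge lives on a compact set. *)
Lemma charge_integral_linear nu K c f g : compact K -> closed K ->
  nu.-null_set (~` K) -> continuous f -> continuous g ->
  charge_integral nu (fun x => c * f x + g x) =
  c * charge_integral nu f + charge_integral nu g.
Proof.
move=> cK clK nuK cf cg; have [P [N [h hE]]] := charge_integral_jordan nu.
have mK : measurable (~` K : set (borel T)).
  by apply: open_borel; exact: closed_openC.
have [pK nK] := (null_set_jordan h mK).1 nuK.
have integrable (m : {finite_measure set (borel T) -> \bar R}) (w : T -> R) :
    m (~` K) = 0%E -> continuous w -> m.-integrable setT (EFin \o w).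
  move=> mK0 cw.
  apply: (@ae_eq_integrable _ _ _ m (EFin \o (fun x => 1 * (w \_ K) x))).
  - by apply/measurable_EFinP; exact: continuous_borel.
  - apply: (ae_eq_off_null_set mK mK0) => x /contrapT Kx.
    by rewrite /= mul1r patchE mem_set.
  - apply: continuous_restrict_integrable => //.
    by move=> x _; rewrite normr1.
have linear (m : {finite_measure set (borel T) -> \bar R}) : m (~` K) = 0%E ->
    \int[m]_x (c * f x + g x) = c * \int[m]_x f x + \int[m]_x g x.
  move=> mK0; have intf := integrable m f mK0 cf.
  have intcf : m.-integrable setT (EFin \o (fun x => c * f x)).
    by apply: integrable => // x; apply: cvgM; [exact: cvg_cst|exact: cf].
  by rewrite (RintegralD measurableT intcf (integrable m g mK0 cg)) RintegralZl.
by rewrite !hE !linear//; ring.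
Qed.

Context (J : finType) (u : J -> T -> R).
Hypothesis u_coord : coordinates u.

(** A point outside S lies in the ball where some bump is positive, chosen so
    small that q max(bump, 0) is a test function near this point for every
    continuous q.  All their integrals vanish, hence the ball is null.  Countably
    many such balls cover the complement of S. *)
Lemma compl_support_null nu (S : set T) :
  (forall x, ~ S x -> exists U, [/\ open U, U x &
    forall f, Cc U f -> charge_integral nu f = 0]) ->
  nu.-null_set (~` S).
Proof.
move=> S_loc; have [P [N [h _]]] := charge_integral_jordan nu.
pose V (k : {ffun J -> rat} * rat) : set T := [set x | 0 < bump u k.1 k.2 x].
have V_open k : open (V k).
  apply: (@open_comp _ _ (bump u k.1 k.2) [set t | 0 < t]) (@open_gt _ 0).
  by move=> x _; exact: bump_continuous.
pose F n : set (borel T) := if choice.unpickle n is Some k then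
  (if `[< nu.-null_set (V k) >] then V k else set0) else set0.
have F_null n : measurable (F n) /\ nu.-null_set (F n).
  have null0 : nu.-null_set set0.
    by move=> B _; rewrite subset0 => ->; rewrite charge0.
  rewrite /F; case: choice.unpickle => [k|]; last by split.
  by case: asboolP => // nuV; split=> //; apply: open_borel; exact: V_open.
have SF : ~` S `<=` \bigcup_n F n.
  move=> x /= Sx; have [U [oU Ux U0]] := S_loc x Sx.
  have [c [r [xcr crU]]] := bump_basis u_coord (open_nbhs_nbhs (conj oU Ux)).
  exists (choice.pickle (c, r)) => //; rewrite /F choice.pickleK.
  case: asboolP => // Vnull; exfalso; apply: Vnull.
  have cb : continuous (bump u c r) by exact: bump_continuous.
  pose w y := Num.max (bump u c r y) 0.
  have cw : continuous w.
    by move=> y; apply: continuous_max; [exact: cb|exact: cst_continuous].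
  have -> : V (c, r) = [set y | 0 < w y].
    by apply/seteqP; split=> y; rewrite /V /w /= lt_max ltxx orbF.
  apply: (null_set_of_orthogonal u_coord (A := [set f | continuous f])
    (K := [set y | 0 <= bump u c r y])) => //.
  - exact: function_algebra_continuous.
  - by have [uc _ _] := u_coord.
  - exact: bump_compact.
  - apply: (@preimage_closed _ _ (bump u c r) [set t | 0 <= t]) (@closed_ge _ 0).
    by move=> y _; exact: cb.
  - by move=> y; rewrite /w le_max lexx orbT.
  - move=> B _ BZ; rewrite (_ : B = set0) ?charge0//.
    apply/seteqP; split=> // y /BZ[]; rewrite /= /w lt_max ltxx orbF.
    by move/ltW.
  move=> q cq; apply: U0.
  have supp_bump : closure [set y | q y * w y != 0] `<=`
      [set y | 0 <= bump u c r y].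
    apply: (subset_trans _ (@bump_closure _ _ _ _ u_coord c r)).
    apply: closure_subset => y /=.
    rewrite mulf_eq0 negb_or => /andP[_]; rewrite /w.
    by case: leP => //; rewrite eqxx.
  split.
  - by move=> y; apply: cvgM; [exact: cq|exact: cw].
  - apply: (subclosed_compact _ (@bump_compact _ _ _ _ u_coord c r) supp_bump).
    exact: closed_closure.
  - exact: subset_trans crU.
have mF n := (F_null n).1.
have m_null (m : {measure set (borel T) -> \bar R}) : (forall n, m (F n) = 0%E) ->
    m.-negligible (~` S).
  move=> m0; apply: (@negligibleS _ _ _ m _ _ SF); apply: negligible_bigcup => n.
  by exists (F n); split.
have [p0 n0] :
    (jordan_pos h).-negligible (~` S) /\ (jordan_neg h).-negligible (~` S).
  have F0 n := (null_set_jordan h (mF n)).1 (F_null n).2.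
  by split; apply: m_null => n; have [] := F0 n.
move=> B mB BS; have : jordan_pos h B = 0%E /\ jordan_neg h B = 0%E.
  by split; [exact: (negligible_null_set p0)|exact: (negligible_null_set n0)].
by move=> /(null_set_jordan h mB) B0; exact: (B0 B mB).
Qed.

End SupportNull.

Lemma compl_measure_supp (T : topologicalType) (K : numFieldType)
    (I : (T -> K) -> K) x : ~ measure_supp I x ->
  exists U : set T, [/\ open U, U x & forall f, Cc U f -> I f = 0].
Proof.
move=> /existsNP[U] /not_implyP[oU] /not_implyP[Ux] noI.
exists U; split=> // f fU; apply/eqP/negPn/negP => If.
by apply: noI; exists f.
Qed.

Lemma closed_measure_supp (T : topologicalType) (K : numFieldType)
  (I : (T -> K) -> K) : closed (measure_supp I).
Proof.
rewrite -[measure_supp I]setCK; apply: open_closedC; rewrite openE => x /=.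
move=> /compl_measure_supp[U [oU Ux U0]].
rewrite /interior nbhsE; exists U => // y Uy suppy.
by have [f /U0 ->] := suppy U oU Uy; rewrite eqxx.
Qed.

(** * The affine case *)

Section AffineCase.
Context (R : realType) (n : nat).
Implicit Types (p q : mpoly n R) (x : 'rV[R]_n).

Lemma rV_coordinates :
  coordinates (fun (j : 'I_n) (x : 'rV[R]_n) => x ord0 j).
Proof.
split=> [j|x U /nbhs_ballP[e /= e0 eU]|M].
- exact: coord_continuous.
- exists (e / 2) => [|y xy]; first by rewrite divr_gt0.
  apply: eU; split=> // i j; rewrite (ord1 i) -ball_normE /= distrC.
  by rewrite (le_lt_trans (xy j))// ltr_pdivrMr// ltr_pMr// ltr1n.
- rewrite (_ : [set _ | _] =
      [set v : 'rV[R]_n | forall j, `[- M, M]%classic (v ord0 j)]).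
    apply: (@rV_compact _ _ (fun=> `[- M, M]%classic)) => _.
    exact: segment_compact.
  by apply/seteqP; split=> v vM j; have := vM j; rewrite /= in_itv/= ler_norml.
Qed.

Lemma mpoly_eval_algebra : function_algebra
  [set f | exists q : mpoly n R, forall x, f x = mpoly_eval x q].
Proof.
split=> [c|f g [p fp] [q gq]|f g [p fp] [q gq]].
- by exists (mpolyC n c) => x; rewrite /mpoly_eval mevalC.
- by exists (p + q) => x; rewrite fp gq /mpoly_eval mevalD.
- by exists (p * q) => x; rewrite fp gq /mpoly_eval mevalM.
Qed.

Lemma mpoly_eval_continuous p : continuous (fun x => mpoly_eval x p).
Proof.
rewrite /mpoly_eval; under eq_fun do rewrite mevalE.
have algC := function_algebra_continuous R 'rV[R]_n; have [cA _ MA] := algC.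
apply: (function_algebra_sum _ algC) => m; apply: MA; first exact: cA.
apply: (function_algebra_prod _ algC) => i; apply: (function_algebra_exp _ algC).
exact: coord_continuous.
Qed.

End AffineCase.

(** A polynomial p orthogonal to all others is orthogonal to q p, that is,
    p^2 is a density orthogonal to all polynomials q. *)
Theorem affine_moment_kernel (R : realType) (n : nat)
    (FR FL : nat -> set (mpoly n R)) (dR dL : nat -> nat)
    (BR : forall d, 'I_(dR d) -> mpoly n R)
    (BL : forall d, 'I_(dL d) -> mpoly n R)
    (mu : {charge set (borel 'rV[R]_n) -> \bar R}) :
  is_filtration FL ->
  (forall d, is_basis (FR d) (BR d)) ->
  (forall d, is_basis (FL d) (BL d)) ->
  let integral := charge_integral mu in
  let supp := measure_supp (T := 'rV[R]_n) integral in
  let sigma := moment_functional (@mpoly_eval n R) integral in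
  let form := moment_form id sigma in
  let H d' d := gram_matrix form (BL d') (BR d) in
  compact supp ->
  forall d : nat, \forall d' \near \oo,
    vanishing_ideal (@mpoly_eval n R) supp `&` FR d =
    kernel_in (H d' d) (BR d).
Proof.
move=> [_ FL_homo FL_cover _ _] BR_basis BL_basis integral supp sigma form H.
move=> supp_compact d.
have supp_closed : closed supp by exact: closed_measure_supp.
have supp_null : mu.-null_set (~` supp).
  by apply: (compl_support_null (rV_coordinates R n)) => x /compl_measure_supp.
have mSC : measurable (~` supp : set (borel 'rV[R]_n)).
  by apply: open_borel; exact: closed_openC.
have integral_linear c (p q : mpoly n R) :
    integral (fun x : 'rV[R]_n => mpoly_eval x (c *: p + q)) =
    c * integral (fun x : 'rV[R]_n => mpoly_eval x p) +
    integral (fun x : 'rV[R]_n => mpoly_eval x q).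
  rewrite /integral -(charge_integral_linear c supp_compact)//.
  - congr charge_integral; apply/funext => x.
    by rewrite /mpoly_eval mevalD mevalZ.
  - exact: mpoly_eval_continuous.
  - exact: mpoly_eval_continuous.
have form_linear w c v1 v2 : form w (c *: v1 + v2) = c * form w v1 + form w v2.
  rewrite /form /moment_form /sigma /moment_functional -integral_linear.
  by rewrite mulrDr scalerAr.
have form_null v : is_subspace [set w | form w v = 0].
  split=> [|c w1 w2 /= w10 w20].
    rewrite /form /moment_form /= mul0r.
    by have := integral_linear (-1) 0 0; rewrite scaler0 addr0 mulN1r addNr.
  move: w10 w20; rewrite /form /moment_form /sigma /moment_functional.
  move=> w10 w20; rewrite /= mulrDl -scalerAl.
  by rewrite integral_linear w10 w20 mulr0 addr0.
have := kernel_in_eventually form_linear form_null FL_homo FL_cover BL_basis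
  (BR_basis d).
apply: filterS => d' ->; apply/seteqP; split=> p /= [].
  move=> p_supp FRp; split=> // q.
  apply: (charge_integral_null mSC supp_null).
    exact: mpoly_eval_continuous.
  move=> x /contrapT /p_supp px.
  by rewrite /mpoly_eval mevalM [X in _ * X]px mulr0.
move=> FRp p_orth; split=> // x supp_x; apply/eqP/negPn/negP => px.
pose w y := mpoly_eval y p ^+ 2.
have cw : continuous w.
  apply: (function_algebra_exp _ (function_algebra_continuous R _)).
  exact: mpoly_eval_continuous.
have oW : open [set y | 0 < w y].
  by apply: (@open_comp _ _ w [set t | 0 < t]) (@open_gt _ 0).
have w_null : mu.-null_set [set y | 0 < w y].
  apply: (null_set_of_orthogonal (rV_coordinates R n)
    (mpoly_eval_algebra R n) _ _ supp_compact) => //.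
  - by move=> j; exists (mpolyX R (mnm1 j)) => y; rewrite /mpoly_eval mevalXU.
  - move=> f [q fq]; rewrite (_ : f = fun x => mpoly_eval x q); last exact/funext.
    exact: mpoly_eval_continuous.
  - by move=> y; exact: sqr_ge0.
  - by apply: subset_null_set supp_null => y [].
  move=> f [q fq]; rewrite -[RHS](p_orth (q * p)).
  congr charge_integral; apply/funext => y.
  by rewrite /mpoly_eval !mevalM fq /w expr2 mulrA.
have [|f [cf _ fW]] := supp_x _ oW.
  by rewrite /= /w exprn_even_gt0.
rewrite /integral (charge_integral_null (open_borel oW) w_null cf) ?eqxx// => y wy.
apply/eqP/negPn/negP => fy; apply: wy; apply: fW.
exact: subset_closure.
Qed.

(** * The topology of the torus *)

Lemma compact_set_type (X : topologicalType) (A : set X) :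
  compact A -> compact [set: set_type A].
Proof.
move=> cA F FF _.
have [|a [Aa Fa]] := cA (set_val @ F) (fmap_proper_filter _ FF).
  by apply: (@filterE _ F) => x; exact: set_valP.
exists (exist _ a (mem_set Aa)); split=> // B U FB [_ [[V oV <-] Va VU]].
have /Fa : (set_val @ F) (set_val @` B).
  by apply: (@filterS _ F _ B) => // x Bx; exists x.
case/(_ V (open_nbhs_nbhs (conj oV Va))) => _ [[x Bx <-] Vx].
by exists x; split=> //; exact: VU.
Qed.

Section ComplexTopology.
Context (R : realType).
Local Notation C := (Cplx R).
Local Notation Re := (@complex.Re R).
Local Notation Im := (@complex.Im R).

Lemma Cplx_gt0 (e : C) : 0 < e -> e = (Re e)%:C%C /\ 0 < Re e.
Proof.
by case: e => a b; rewrite ltcE /= => /andP[/eqP -> a0].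
Qed.

Lemma normc_le_ReIm (z : C) (e : R) :
  `|Re z| <= e -> `|Im z| <= e -> `|z| <= (2 * e)%:C%C.
Proof.
move=> re im; rewrite [z]complexE; apply: le_trans (ler_normD _ _) _.
rewrite mulrDl mul1r rmorphD/=; apply: lerD.
  by rewrite normc_def /= expr0n addr0 sqrtr_sqr lecR.
by rewrite normrM !normc_def /= !expr0n /= !addr0 !add0r expr1n sqrtr1 mul1r
  sqrtr_sqr lecR.
Qed.

Lemma normc_ge_Im (z : C) : `|Im z|%:C%C <= `|z|.
Proof.
rewrite normc_def lecR -sqrtr_sqr ler_sqrt ?addr_ge0 ?sqr_ge0//.
by rewrite lerDr sqr_ge0.
Qed.

Lemma Re_continuous : continuous (Re : C -> R).
Proof.
move=> z; apply/(@cvgrPdist_lt _ _ _ (nbhs z) (nbhs_filter z)) => e e0.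
have eC : 0 < (e%:C%C : C) by rewrite ltcR.
have := nbhsx_ballx z _ eC; apply: filterS => y; rewrite -ball_normE /= => zy.
have -> : Re z - Re y = Re (z - y) by case: (z) (y) => a b [].
by rewrite -ltcR; exact: le_lt_trans (normc_ge_Re _) zy.
Qed.

Lemma Im_continuous : continuous (Im : C -> R).
Proof.
move=> z; apply/(@cvgrPdist_lt _ _ _ (nbhs z) (nbhs_filter z)) => e e0.
have eC : 0 < (e%:C%C : C) by rewrite ltcR.
have := nbhsx_ballx z _ eC; apply: filterS => y; rewrite -ball_normE /= => zy.
have -> : Im z - Im y = Im (z - y) by case: (z) (y) => a b [].
by rewrite -ltcR; exact: le_lt_trans (normc_ge_Im _) zy.
Qed.

Lemma complex_continuous (X : topologicalType) (f g : X -> R) :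
  continuous f -> continuous g -> continuous (fun x => Complex (f x) (g x) : C).
Proof.
move=> cf cg x; apply/cvgrPdist_lt => e /Cplx_gt0[-> e0].
have e4 : 0 < Re e / 4 by rewrite divr_gt0.
near=> y; apply: (@le_lt_trans _ _ (2 * (Re e / 4))%:C%C).
  apply: normc_le_ReIm => /=; apply: ltW; near: y; apply: cvgr_dist_lt => //.
    exact: cf.
  exact: cg.
by rewrite ltcR; lra.
Unshelve. all: by end_near. Qed.

(** The circle is closed and lies in the image of a square under the continuous
    map (a, b) |-> a + i b. *)
Lemma unit_circle_compact : compact [set z : C | `|z| = 1].
Proof.
have norm1 (z : C) : `|z| = 1 <-> Re z ^+ 2 + Im z ^+ 2 = 1.
  rewrite normc_def; split=> [/complexI h|->]; last by rewrite sqrtr1.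
  by rewrite -[LHS]sqr_sqrtr ?h ?expr1n// addr_ge0// sqr_ge0.
pose D := `[(-1 : R), 1]%classic `*` `[(-1 : R), 1]%classic.
pose phi (ab : R * R) : C := Complex ab.1 ab.2.
have phi_cont : continuous phi.
  by apply: complex_continuous => x; [exact: cvg_fst|exact: cvg_snd].
have cD : compact (phi @` D).
  apply: continuous_compact; first exact: continuous_subspaceT.
  by apply: compact_setX; exact: segment_compact.
apply: (subclosed_compact _ cD).
  pose N (z : C) := Re z ^+ 2 + Im z ^+ 2.
  have cN : continuous N.
    have [_ DA _] := function_algebra_continuous R C.
    have := function_algebra_exp 2 (function_algebra_continuous R C) Re_continuous.
    move=> /DA; apply.
    exact: function_algebra_exp (function_algebra_continuous R C) Im_continuous.
  rewrite (_ : [set z | _] = N @^-1` [set 1]); last by apply/seteqP; split=> z /norm1.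
  apply: preimage_closed; last exact: closed_eq.
  by move=> z _; exact: cN.
move=> z /norm1 zz; exists (Re z, Im z); last by case: z zz.
have := sqr_ge0 (Re z); have := sqr_ge0 (Im z).
by split; rewrite /= in_itv /=; apply/andP; split; nra.
Qed.

End ComplexTopology.

Section TorusTopology.
Context (R : realType) (n : nat).
Local Notation C := (Cplx R).

Definition torus_coord (k : 'I_n * bool) (z : torus_type n R) : R :=
  if k.2 then complex.Re (set_val z ord0 k.1)
  else complex.Im (set_val z ord0 k.1).

Lemma torus_coord_continuous k : continuous (torus_coord k).
Proof.
have cval : continuous (set_val : torus_type n R -> 'rV[C]_n).
  exact: initial_continuous.
have ccoord : continuous (fun z : torus_type n R => set_val z ord0 k.1).
  move=> z.
  apply: (@continuous_comp _ _ _ set_val (fun M : 'rV[C]_n => M ord0 k.1)).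
    exact: cval.
  exact: coord_continuous.
rewrite /torus_coord; case: k.2 => z.
  exact: (continuous_comp (ccoord z) (@Re_continuous R _)).
exact: (continuous_comp (ccoord z) (@Im_continuous R _)).
Qed.

Lemma torus_compact : compact [set: torus_type n R].
Proof.
apply: compact_set_type.
apply: (@rV_compact _ _ (fun=> [set z : C | `|z| = 1])) => _.
exact: unit_circle_compact.
Qed.

Lemma torus_coordinates : coordinates torus_coord.
Proof.
split=> [k|z U [_ [[V oV <-] Vz VU]]|M]; first exact: torus_coord_continuous.
- have /nbhs_ballP[e /= /Cplx_gt0[eE e0] eV] := open_nbhs_nbhs (conj oV Vz).
  exists (complex.Re e / 4) => [|y yz]; first by rewrite divr_gt0.
  apply/VU/eV; split=> [|i j]; first by rewrite eE ltcR.
  rewrite (ord1 i) -ball_normE /= eE.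
  apply: (@le_lt_trans _ _ (2 * (complex.Re e / 4))%:C%C); last by rewrite ltcR; lra.
  apply: normc_le_ReIm; rewrite raddfB distrC.
    exact: (yz (j, true)).
  exact: (yz (j, false)).
- apply: (subclosed_compact _ torus_compact) => //.
  rewrite (_ : [set y | _] =
      \bigcap_(k in setT) (torus_coord k @^-1` [set t | `|t| <= M])).
    apply: closed_bigI => k _; apply: preimage_closed.
      by move=> z _; exact: torus_coord_continuous.
    apply: (@preimage_closed _ _ (fun t : R => `|t|) [set t : R | t <= M]) (@closed_le _ M).
    by move=> t _; exact: norm_continuous.
  apply/seteqP; split=> y yM k; first by move=> _; exact: yM.
  exact: (yM k I).
Qed.

End TorusTopology.

(** * Laurent polynomials on the torus *)

Section LaurentEvaluation.
Context (n : nat) (K : fieldType) (z : 'rV[K]_n).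
Implicit Types (p q : laurent n K) (a b : 'rV[int]_n).

Let monomial a : K := \prod_(i < n) z ord0 i ^ a ord0 i.

Let laurent_evalE (d : {fset 'rV[int]_n}) p : (monalg.msupp p `<=` d)%fset ->
  laurent_eval z p = \sum_(a <- d) laurent_coef p a * monomial a.
Proof.
move=> pd; rewrite /laurent_eval (big_fset_incl _ pd)// => a _.
by move=> /mcoeff_outdom pa; rewrite /laurent_coef pa mul0r.
Qed.

Lemma laurent_evalD p q :
  laurent_eval z (p + q) = laurent_eval z p + laurent_eval z q.
Proof.
rewrite (laurent_evalE (msuppD_le p q)) (laurent_evalE (fsubsetUl _ (monalg.msupp q))).
rewrite (laurent_evalE (fsubsetUr (monalg.msupp p) _)) -big_split/=.
by apply: eq_bigr => a _; rewrite /laurent_coef monalg.mcoeffD mulrDl.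
Qed.

Lemma laurent_eval0 : laurent_eval z 0 = 0.
Proof. by rewrite /laurent_eval monalg.msupp0 big_seq_fset0. Qed.

Lemma laurent_eval_sum I (r : seq I) (F : I -> laurent n K) :
  laurent_eval z (\sum_(i <- r) F i) = \sum_(i <- r) laurent_eval z (F i).
Proof. exact: (big_morph _ laurent_evalD laurent_eval0). Qed.

Lemma laurent_evalZ c p : laurent_eval z (c *: p) = c * laurent_eval z p.
Proof.
rewrite (laurent_evalE (d := monalg.msupp p)).
  rewrite mulr_sumr; apply: eq_bigr => a _.
  by rewrite /laurent_coef monalg.mcoeffZ mulrA.
exact: msuppZ_le.
Qed.

Lemma laurent_eval_term c a : laurent_eval z (laurent_term c a) = c * monomial a.
Proof.
by rewrite (laurent_evalE msuppU_le) big_seq_fset1 /laurent_coef mcoeffUU.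
Qed.

Hypothesis z_neq0 : forall i, z ord0 i != 0.

Let monomialD a b : monomial (a + b) = monomial a * monomial b.
Proof.
rewrite /monomial -big_split/=; apply: eq_bigr => i _.
by rewrite mxE expfzDr.
Qed.

Lemma laurent_evalM p q :
  laurent_eval z (p * q) = laurent_eval z p * laurent_eval z q.
Proof.
rewrite -[p * q]/(laurent_mul p q) laurent_eval_sum mulr_suml.
apply: eq_bigr => a _; rewrite laurent_eval_sum mulr_sumr; apply: eq_bigr => b _.
by rewrite laurent_eval_term monomialD mulrACA.
Qed.

Lemma laurent_eval_mpoly (p : mpoly n K) :
  laurent_eval z (laurent_of_mpoly p) = meval (z ord0) p.
Proof.
rewrite laurent_eval_sum mevalE; apply: eq_bigr => m _.
rewrite laurent_eval_term; congr (_ * _); apply: eq_bigr => i _.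
by rewrite mxE.
Qed.

End LaurentEvaluation.

Section TorusEvaluation.
Context (R : realType) (n : nat).
Local Notation C := (Cplx R).
Implicit Types (z : torus_type n R) (p q : laurent n C) (f g : torus_type n R -> C).

Lemma torus_norm z i : `|set_val z ord0 i| = 1.
Proof. by have := set_valP z; exact. Qed.

Lemma torus_neq0 z i : set_val z ord0 i != 0.
Proof. by rewrite -normr_eq0 torus_norm oner_eq0. Qed.

Lemma torus_conj z i : Num.conj (set_val z ord0 i) = (set_val z ord0 i)^-1.
Proof. by rewrite invC_norm torus_norm expr1n invr1 mul1r. Qed.

Lemma torus_evalD z p q : torus_eval z (p + q) = torus_eval z p + torus_eval z q.
Proof. exact: laurent_evalD. Qed.

Lemma torus_evalM z p q : torus_eval z (p * q) = torus_eval z p * torus_eval z q.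
Proof. by apply: laurent_evalM => i; exact: torus_neq0. Qed.

(** On the torus the inverse of a coordinate is its conjugate, so that the
    involution of the Laurent polynomials is pointwise conjugation. *)
Lemma torus_eval_conj z p : torus_eval z (laurent_conj p) = Num.conj (torus_eval z p).
Proof.
rewrite /torus_eval laurent_eval_sum rmorph_sum; apply: eq_bigr => a _.
rewrite laurent_eval_term rmorphM rmorph_prod; congr (_ * _).
apply: eq_bigr => i _; rewrite mxE -exprz_inv -torus_conj.
by rewrite rmorphXz// unitfE torus_neq0.
Qed.

Lemma torus_eval_mpoly z (v : mpoly n C) :
  torus_eval z (laurent_of_mpoly v) = meval (set_val z ord0) v.
Proof. exact: laurent_eval_mpoly. Qed.

(** On the torus the inverse of a coordinate is its conjugate, so that the
    involution of the Laurent polynomials is pointwise conjugation. *)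
Lemma torus_eval_conj_mpoly z q (v : mpoly n C) :
  torus_eval z (laurent_conj q * laurent_of_mpoly v) =
  Num.conj (torus_eval z q) * meval (set_val z ord0) v.
Proof.
rewrite (torus_evalM z (laurent_conj q)) torus_eval_conj; congr (_ * _).
exact: torus_eval_mpoly.
Qed.

(** The real trigonometric polynomials. *)
Definition real_laurent : set (torus_type n R -> R) :=
  [set f | exists q : laurent n C, forall z, torus_eval z q = (f z)%:C%C].

Lemma real_laurent_algebra : function_algebra real_laurent.
Proof.
split=> [c|f g [p fp] [q gq]|f g [p fp] [q gq]].
- exists (laurent_term (c%:C%C : C) 0) => z.
  rewrite /torus_eval laurent_eval_term big1 ?mulr1// => i _.
  by rewrite mxE expr0z.
- by exists (p + q) => z; rewrite torus_evalD fp gq rmorphD.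
- by exists (p * q) => z; rewrite torus_evalM fp gq rmorphM.
Qed.

(** The real and imaginary parts of x_i are (x_i + x_i^-1)/2 and
    i(x_i^-1 - x_i)/2 on the torus. *)
Lemma real_laurent_coord k : real_laurent (@torus_coord R n k).
Proof.
case: k => i b.
pose e : 'rV[int]_n := delta_mx ord0 i.
have mono z : laurent_eval (set_val z) (laurent_term (1 : C) e) =
    set_val z ord0 i.
  rewrite laurent_eval_term mul1r (bigD1 i)//= mxE !eqxx expr1z big1 ?mulr1//.
  by move=> j /negPf ji; rewrite mxE eqxx ji expr0z.
have monoN z : laurent_eval (set_val z) (laurent_term (1 : C) (- e)) =
    Num.conj (set_val z ord0 i).
  rewrite torus_conj laurent_eval_term mul1r (bigD1 i)//= !mxE !eqxx exprN1.
  rewrite big1 ?mulr1//.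
  by move=> j /negPf ji; rewrite !mxE eqxx ji oppr0 expr0z.
pose cst (c : C) : laurent n C := laurent_term c 0.
have cstE c z : laurent_eval (set_val z) (cst c) = c.
  by rewrite laurent_eval_term big1 ?mulr1// => j _; rewrite mxE expr0z.
rewrite /torus_coord; case: b => /=.
  exists (cst 2^-1 * (laurent_term 1 e + laurent_term 1 (- e))) => z.
  rewrite (torus_evalM z (cst _)) (torus_evalD z (laurent_term 1 e)).
  rewrite /torus_eval cstE mono monoN.
  by rewrite ReJ_add mulrC.
exists (cst ('i%C / 2) * (laurent_term 1 (- e) + laurent_term (-1) e)) => z.
rewrite (torus_evalM z (cst _)) (torus_evalD z (laurent_term 1 (- e))).
rewrite /torus_eval cstE monoN.
rewrite laurent_eval_term mulN1r -[X in _ - X]mul1r -laurent_eval_term mono.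
by rewrite ImJ_sub [RHS]mulrC mulrA [LHS]mulrAC.
Qed.

Lemma torus_eval_continuous q : continuous (fun z => torus_eval z q).
Proof.
have algC := function_algebra_continuous C (torus_type n R); have [cA _ MA] := algC.
apply: (function_algebra_sum _ algC) => a; apply: MA; first exact: cA.
apply: (function_algebra_prod _ algC) => i.
have coordC : continuous (fun z : torus_type n R => set_val z ord0 i).
  move=> z; apply: (@continuous_comp _ _ _ set_val (fun M : 'rV[C]_n => M ord0 i)).
    exact: initial_continuous.
  exact: coord_continuous.
case: (a ord0 i) => k; first exact: (function_algebra_exp _ algC).
have -> : (fun z : torus_type n R => set_val z ord0 i ^ Negz k) =
    (fun z => (set_val z ord0 i)^-1 ^+ k.+1).
  by apply/funext => z; rewrite exprVn.
apply: (function_algebra_exp _ algC).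
by move=> z; exact: (cvgV (torus_neq0 z i) (coordC z)).
Qed.

Lemma real_laurent_continuous :
  real_laurent `<=` [set f : torus_type n R -> R | continuous f].
Proof.
move=> f [q fq].
have -> : f = @complex.Re R \o (fun z => torus_eval z q).
  by apply/funext => z; rewrite /= fq.
move=> z; apply: continuous_comp; first exact: torus_eval_continuous.
exact: Re_continuous.
Qed.

End TorusEvaluation.

(** * Integration against a complex measure *)

Section ComplexIntegral.
Context (R : realType) (T : ptopologicalType).
Local Notation C := (Cplx R).
Local Notation Re := (@complex.Re R).
Local Notation Im := (@complex.Im R).
Implicit Types (mu : complex_measure (borel T) R) (f g : T -> C).

Lemma charge_integral0 (nu : {charge set (borel T) -> \bar R}) :
  charge_integral nu (fun=> 0) = 0.
Proof.
apply: (@charge_integral_null _ _ nu set0) => //.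
  by move=> B _; rewrite subset0 => ->; rewrite charge0.
by move=> x; exact: cst_continuous.
Qed.

Lemma complex_integral_real mu (f : T -> R) :
  complex_integral mu (fun x => (f x)%:C%C : C) =
  Complex (charge_integral (re_measure mu) f) (charge_integral (im_measure mu) f).
Proof. by rewrite /complex_integral /= !charge_integral0 subr0 addr0. Qed.

Lemma complex_integral_null mu Z f : measurable (Z : set (borel T)) ->
  (re_measure mu).-null_set Z -> (im_measure mu).-null_set Z ->
  continuous f -> (forall x, ~ Z x -> f x = 0) -> complex_integral mu f = 0.
Proof.
move=> mZ reZ imZ cf f0.
have cRe : continuous (fun x => Re (f x)).
  by move=> x; exact: (continuous_comp (cf x) (@Re_continuous R _)).
have cIm : continuous (fun x => Im (f x)).
  by move=> x; exact: (continuous_comp (cf x) (@Im_continuous R _)).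
have Re0 x : ~ Z x -> Re (f x) = 0 by move/f0 ->.
have Im0 x : ~ Z x -> Im (f x) = 0 by move/f0 ->.
rewrite /complex_integral (charge_integral_null mZ reZ cRe Re0).
rewrite (charge_integral_null mZ reZ cIm Im0).
rewrite (charge_integral_null mZ imZ cRe Re0).
by rewrite (charge_integral_null mZ imZ cIm Im0) subr0 addr0.
Qed.

Lemma complex_integral_linear mu K c f g : compact K -> closed K ->
  (re_measure mu).-null_set (~` K) -> (im_measure mu).-null_set (~` K) ->
  continuous f -> continuous g ->
  complex_integral mu (fun x => c * f x + g x) =
  c * complex_integral mu f + complex_integral mu g.
Proof.
move=> cK clK reK imK cf cg.
have cRe (h : T -> C) : continuous h -> continuous (fun x => Re (h x)).
  by move=> ch x; exact: (continuous_comp (ch x) (@Re_continuous R _)).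
have cIm (h : T -> C) : continuous h -> continuous (fun x => Im (h x)).
  by move=> ch x; exact: (continuous_comp (ch x) (@Im_continuous R _)).
have [_ DA MA] := function_algebra_continuous R T.
have linear2 (nu : {charge set (borel T) -> \bar R}) a b (h1 h2 h3 : T -> R) :
    nu.-null_set (~` K) -> continuous h1 -> continuous h2 -> continuous h3 ->
    charge_integral nu (fun x => a * h1 x + (b * h2 x + h3 x)) =
    a * charge_integral nu h1 + (b * charge_integral nu h2 + charge_integral nu h3).
  move=> nuK ch1 ch2 ch3.
  rewrite (charge_integral_linear a cK clK nuK ch1 (g := fun x => b * h2 x + h3 x)).
    by rewrite (charge_integral_linear b cK clK nuK ch2 ch3).
  apply: (DA _ _ _ ch3); apply: (MA (fun=> b) _ _ ch2).
  by move=> x; exact: cst_continuous.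
have ReE : (fun x => Re (c * f x + g x)) =
    (fun x => Re c * Re (f x) + (- Im c * Im (f x) + Re (g x))).
  apply/funext => x; case: (c) (f x) (g x) => c1 c2 [f1 f2] [g1 g2] /=.
  by rewrite mulNr addrA.
have ImE : (fun x => Im (c * f x + g x)) =
    (fun x => Re c * Im (f x) + (Im c * Re (f x) + Im (g x))).
  apply/funext => x; case: (c) (f x) (g x) => c1 c2 [f1 f2] [g1 g2] /=.
  by rewrite addrA.
rewrite /complex_integral ReE ImE !linear2//; do ?[exact: cRe|exact: cIm].
case: c {ReE ImE} => c1 c2 /=.
by apply/eqP; rewrite eq_complex /=; apply/andP; split; apply/eqP; ring.
Qed.

End ComplexIntegral.

(** * The trigonometric case *)

(** Here q is replaced by f p with f a real trigonometric polynomial; since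
    |p|^2 is real, the integrals against the real and the imaginary part of the
    measure vanish separately. *)
Theorem trigonometric_moment_kernel (R : realType) (n : nat)
    (FR : nat -> set (mpoly n (Cplx R))) (FL : nat -> set (laurent n (Cplx R)))
    (dR dL : nat -> nat)
    (BR : forall d, 'I_(dR d) -> mpoly n (Cplx R))
    (BL : forall d, 'I_(dL d) -> laurent n (Cplx R))
    (mu : complex_measure (borel (torus_type n R)) R) :
  is_filtration FL ->
  (forall d, is_basis (FR d) (BR d)) ->
  (forall d, is_basis (FL d) (BL d)) ->
  let integral := complex_integral mu in
  let supp := measure_supp (T := torus_type n R) integral in
  let sigma := moment_functional (@torus_eval n R) integral in
  let form := moment_form (@laurent_conj n (Cplx R)) sigma in
  let H d' d :=
    gram_matrix (fun w v => form w (laurent_of_mpoly v)) (BL d') (BR d) in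
  compact supp ->
  forall d : nat, \forall d' \near \oo,
    @laurent_of_mpoly n (Cplx R) @^-1`
      vanishing_ideal (@torus_eval n R) supp `&` FR d =
    kernel_in (H d' d) (BR d).
Proof.
move=> [_ FL_homo FL_cover _ _] BR_basis BL_basis integral supp sigma form H.
move=> supp_compact d.
have supp_closed : closed supp by exact: closed_measure_supp.
(* Real test functions separate the two charges. *)
have supp_loc x : ~ supp x -> exists U, [/\ open U, U x &
    forall f : torus_type n R -> R, Cc U f ->
      charge_integral (re_measure mu) f = 0 /\
      charge_integral (im_measure mu) f = 0].
  move=> /compl_measure_supp[U [oU Ux U0]]; exists U; split=> // f [cf Kf fU].
  have fC : Cc U (fun x => (f x)%:C%C : Cplx R).
    have supE : [set x | ((f x)%:C%C : Cplx R) != 0] = [set x | f x != 0].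
      by apply/seteqP; split=> y; rewrite /= (inj_eq (@complexI R)).
    rewrite /Cc /= supE; split=> //; apply: complex_continuous cf _ => y.
    exact: cst_continuous.
  have := U0 _ fC; rewrite /integral complex_integral_real.
  by move=> /eqP; rewrite eq_complex /= => /andP[/eqP -> /eqP ->].
have re_null : (re_measure mu).-null_set (~` supp).
  apply: (compl_support_null (torus_coordinates R n)) => x.
  by move=> /supp_loc[U [oU Ux U0]]; exists U; split=> // f /U0[].
have im_null : (im_measure mu).-null_set (~` supp).
  apply: (compl_support_null (torus_coordinates R n)) => x.
  by move=> /supp_loc[U [oU Ux U0]]; exists U; split=> // f /U0[].
have mSC : measurable (~` supp : set (borel (torus_type n R))).
  by apply: open_borel; exact: closed_openC.
have int_linear c (f g : torus_type n R -> Cplx R) :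
    continuous f -> continuous g ->
    integral (fun z => c * f z + g z) = c * integral f + integral g.
  exact: (complex_integral_linear c supp_compact).
pose E w v (z : torus_type n R) : Cplx R :=
  Num.conj (torus_eval z w) * meval (set_val z ord0) v.
have EE w v : (fun z => torus_eval z (laurent_conj w * laurent_of_mpoly v)) =
    E w v.
  by apply/funext => z; exact: torus_eval_conj_mpoly.
have E_cont w v : continuous (E w v).
  by rewrite -EE; exact: torus_eval_continuous.
pose s w v := integral (E w v).
have s_linear w c (v1 v2 : mpoly n (Cplx R)) :
    s w (c *: v1 + v2) = c * s w v1 + s w v2.
  rewrite /s -int_linear//; congr integral; apply/funext => z.
  by rewrite /E mevalD mevalZ mulrDr mulrCA.
have s_null (v : mpoly n (Cplx R)) : is_subspace [set w | s w v = 0].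
  split=> [|c w1 w2]; rewrite /= /s.
    have := int_linear (-1) _ _ (E_cont 0 v) (E_cont 0 v).
    rewrite mulN1r addNr => <-; congr integral; apply/funext => z.
    by rewrite /E {1}/torus_eval laurent_eval0 rmorph0 mul0r mulN1r addNr.
  move=> w10 w20.
  have := int_linear (Num.conj c) _ _ (E_cont w1 v) (E_cont w2 v).
  rewrite w10 w20 mulr0 addr0 => <-; congr integral; apply/funext => z.
  rewrite /E torus_evalD {1}/torus_eval laurent_evalZ.
  by rewrite rmorphD rmorphM mulrDl mulrA.
have HE d' : H d' d = gram_matrix s (BL d') (BR d).
  by apply/matrixP => i j; rewrite !mxE /s -EE.
have := kernel_in_eventually s_linear s_null FL_homo FL_cover BL_basis
  (BR_basis d).
apply: filterS => d'; rewrite HE => ->; apply/seteqP; split=> p /= [].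
  move=> p_supp FRp; split=> // q.
  apply: (complex_integral_null mSC re_null im_null (E_cont q p)) => z.
  by move=> /contrapT /p_supp; rewrite torus_eval_mpoly /E => ->; rewrite mulr0.
move=> FRp p_orth; split=> // x supp_x; apply/eqP/negPn/negP.
rewrite torus_eval_mpoly => px.
pose m (z : torus_type n R) : Cplx R := meval (set_val z ord0) p.
have m_cont : continuous m.
  rewrite (_ : m = fun z => torus_eval z (laurent_of_mpoly p)).
    exact: torus_eval_continuous.
  by apply/funext => z; rewrite torus_eval_mpoly.
pose w z : R := complex.Re (m z) ^+ 2 + complex.Im (m z) ^+ 2.
have wE z : ((w z)%:C%C : Cplx R) = Num.conj (m z) * m z.
  by rewrite /w add_Re2_Im2 normCK mulrC.
have cw : continuous w.
  have algR := function_algebra_continuous R (torus_type n R).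
  have [_ DA _] := algR.
  apply: DA; apply: (function_algebra_exp _ algR) => z.
    exact: (continuous_comp (m_cont z) (@Re_continuous R _)).
  exact: (continuous_comp (m_cont z) (@Im_continuous R _)).
have oW : open [set y | 0 < w y].
  by apply: (@open_comp _ _ w [set t | 0 < t]) (@open_gt _ 0).
(* Testing against f p, for a real trigonometric polynomial f, makes the
   integrand the real function f |p|^2. *)
have w_orth f : real_laurent f ->
    charge_integral (re_measure mu) (fun y => f y * w y) = 0 /\
    charge_integral (im_measure mu) (fun y => f y * w y) = 0.
  move=> [q fq]; have := p_orth (q * laurent_of_mpoly p).
  rewrite /s (_ : E _ p = fun y => (f y * w y)%:C%C).
    rewrite /integral complex_integral_real.
    by move=> /eqP; rewrite eq_complex /= => /andP[/eqP -> /eqP ->].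
  apply/funext => y; rewrite /E -[meval _ p]/(m y).
  rewrite torus_evalM torus_eval_mpoly fq rmorphM [RHS]rmorphM /= wE mulrA.
  by congr (_ * _ * _); exact: conjc_real.
have w_ge0 y : 0 <= w y by rewrite addr_ge0 ?sqr_ge0.
have w_null (nu : {charge set (borel (torus_type n R)) -> \bar R}) :
    nu.-null_set (~` supp) ->
    (forall f, real_laurent f -> charge_integral nu (fun y => f y * w y) = 0) ->
    nu.-null_set [set y | 0 < w y].
  move=> nu_null nu_orth; apply: (null_set_of_orthogonal (torus_coordinates R n)
    (real_laurent_algebra R n) _ _ supp_compact) => //.
  - exact: real_laurent_coord.
  - exact: real_laurent_continuous.
  - by apply: subset_null_set nu_null => y [].
have [|f [cf _ fW]] := supp_x _ oW.
  rewrite /= lt_neqAle w_ge0 andbT eq_sym -(inj_eq (@complexI R)) wE.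
  by rewrite mulf_neq0// fmorph_eq0.
rewrite /integral (complex_integral_null (open_borel oW) _ _ cf) ?eqxx//.
- by apply: w_null => // g /w_orth[].
- by apply: w_null => // g /w_orth[].
move=> y wy; apply/eqP/negPn/negP => fy; apply: wy; apply: fW.
exact: subset_closure.
Qed.

(** * The vanishing ideal of the support as a kernel *)

Theorem theorem4p3 (R : realType) (n : nat) :
  (* Affine case. *)
  (forall (FR FL : nat -> set (mpoly n R)) (dR dL : nat -> nat)
      (BR : forall d, 'I_(dR d) -> mpoly n R)
      (BL : forall d, 'I_(dL d) -> mpoly n R)
      (mu : {charge set (borel 'rV[R]_n) -> \bar R}),
    is_filtration FR -> is_filtration FL ->
    (forall d, finite_dimensional (FR d)) ->
    (forall d, finite_dimensional (FL d)) ->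
    (forall d, is_basis (FR d) (BR d)) ->
    (forall d, is_basis (FL d) (BL d)) ->
    let integral := charge_integral mu in
    let supp := measure_supp (T := 'rV[R]_n) integral in
    let sigma := moment_functional (@mpoly_eval n R) integral in
    let form := moment_form id sigma in
    let H d' d := gram_matrix form (BL d') (BR d) in
    compact supp ->
    forall d : nat, \forall d' \near \oo,
      vanishing_ideal (@mpoly_eval n R) supp `&` FR d =
      kernel_in (H d' d) (BR d))
  /\
  (* Trigonometric case. *)
  (forall (FR : nat -> set (mpoly n (Cplx R)))
      (FL : nat -> set (laurent n (Cplx R))) (dR dL : nat -> nat)
      (BR : forall d, 'I_(dR d) -> mpoly n (Cplx R))
      (BL : forall d, 'I_(dL d) -> laurent n (Cplx R))
      (mu : complex_measure (borel (torus_type n R)) R),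
    is_filtration FR -> is_filtration FL ->
    (forall d, finite_dimensional (FR d)) ->
    (forall d, finite_dimensional (FL d)) ->
    (forall d, is_basis (FR d) (BR d)) ->
    (forall d, is_basis (FL d) (BL d)) ->
    let integral := complex_integral mu in
    let supp := measure_supp (T := torus_type n R) integral in
    let sigma := moment_functional (@torus_eval n R) integral in
    let form := moment_form (@laurent_conj n (Cplx R)) sigma in
    let H d' d :=
      gram_matrix (fun w v => form w (laurent_of_mpoly v)) (BL d') (BR d) in
    compact supp ->
    forall d : nat, \forall d' \near \oo,
      @laurent_of_mpoly n (Cplx R) @^-1`
        vanishing_ideal (@torus_eval n R) supp `&` FR d =
      kernel_in (H d' d) (BR d)).
Proof.
split.
  move=> FR FL dR dL BR BL mu _ filtL _ _ basisR basisL.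
  exact: affine_moment_kernel filtL basisR basisL.
move=> FR FL dR dL BR BL mu _ filtL _ _ basisR basisL.
exact: trigonometric_moment_kernel filtL basisR basisL.
Qed.
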